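(* Let $\Gamma$ be a surface group that is commensurable to either the nonabelian free group $F_2$ of rank two or the fundamental group $\Gamma_2$ of the closed oriented surface of genus two, and let $n>1$ be an integer. Then $\operatorname{Comm}(\Gamma)$ contains a subgroup isomorphic to $\operatorname{BS}(1,n)$. Moreover, $\operatorname{Comm}(\Gamma)$ contains a non-residually finite image of $\operatorname{BS}(2,3)$; that is, there is a group homomorphism $\operatorname{BS}(2,3)\to \operatorname{Comm}(\Gamma)$ whose image is not a residually finite group.
   Context: For a group $G$, the abstract commensurator $\operatorname{Comm}(G)$ is the set of equivalence classes of isomorphisms $\phi:H_1\to H_2$ between finite-index subgroups $H_1,H_2\le G$, where two such isomorphisms are equivalent if they are both defined and equal on a common finite-index subgroup of $G$. It is a group under composition (composition of representatives after restricting to suitable finite-index subgroups). For integers $m,n$, the Baumslag--Solitar group is $\operatorname{BS}(m,n)=\langle a,b : a b^m a^{-1}=b^n\rangle$. A surface group is the fundamental group of a (connected) surface with finite genus and finitely many punctures and boundary components. Two groups are commensurable if they have isomorphic finite-index subgroups. The group $\Gamma_2$ has the presentation $\langle A,B,C,D : [A,B][C,D]\rangle$, where $[X,Y]=XYX^{-1}Y^{-1}$. A group is residually finite if for every nontrivial element there is a homomorphism to a finite group not killing that element. *)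

(* Defs.v *)
From HB Require Import structures.
From mathcomp Require Import all_boot all_order all_algebra fingroup.
From mathcomp Require Import all_classical all_reals all_analysis.
From mathcomp Require Import homotopy lra.

Set Implicit Arguments.
Unset Strict Implicit.
Unset Printing Implicit Defensive.

Import Order.TTheory GRing.Theory Num.Theory.
Import numFieldNormedType.Exports.

Local Open Scope classical_set_scope.
Local Open Scope group_scope.

(* A group presented as a type of representatives, with operations that satisfy
   the group laws up to an equivalence relation compatible with them. *)
Record pregroup := Pregroup {
  pg_sort :> Type;
  pg_eqv : pg_sort -> pg_sort -> Prop;
  pg_one : pg_sort;
  pg_inv : pg_sort -> pg_sort;
  pg_mul : pg_sort -> pg_sort -> pg_sort;
  pg_refl : forall x, pg_eqv x x;
  pg_sym : forall x y, pg_eqv x y -> pg_eqv y x;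
  pg_trans : forall y x z, pg_eqv x y -> pg_eqv y z -> pg_eqv x z;
  pg_invE : forall x x', pg_eqv x x' -> pg_eqv (pg_inv x) (pg_inv x');
  pg_mulE : forall x x' y y', pg_eqv x x' -> pg_eqv y y' ->
    pg_eqv (pg_mul x y) (pg_mul x' y');
  pg_mulA : forall x y z,
    pg_eqv (pg_mul x (pg_mul y z)) (pg_mul (pg_mul x y) z);
  pg_mul1 : forall x, pg_eqv (pg_mul pg_one x) x;
  pg_mulV : forall x, pg_eqv (pg_mul (pg_inv x) x) pg_one
}.

Section QuotGroup.
Local Open Scope quotient_scope.
Variable P : pregroup.
Implicit Types x y : P.

Definition pg_rel (x y : {classic P}) : bool := `[< pg_eqv x y >].

Fact pg_rel_equiv : equiv_class_of pg_rel.
Proof.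
split=> [x|x y|y x z]; first by apply/asboolP/pg_refl.
  by apply/asboolP/asboolP => /pg_sym.
by move=> /asboolP xy /asboolP yz; apply/asboolP/(pg_trans xy yz).
Qed.
Canonical pg_equiv_rel := EquivRelPack pg_rel_equiv.

Definition quot_group := {eq_quot pg_rel}.
HB.instance Definition _ := Choice.on quot_group.
HB.instance Definition _ := Quotient.on quot_group.

Definition pg_class (x : P) : quot_group := \pi_quot_group (x : {classic P}).
Definition pg_repr (c : quot_group) : P := generic_quotient.repr c.

Lemma pg_classE x y : pg_class x = pg_class y <-> pg_eqv x y.
Proof.
split=> [/eqmodP /asboolP //|xy].
by apply/eqmodP/asboolP.
Qed.

Lemma pg_reprK c : pg_class (pg_repr c) = c.
Proof. exact: reprK. Qed.

Lemma pg_classK x : pg_eqv (pg_repr (pg_class x)) x.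
Proof. by apply/pg_classE; rewrite pg_reprK. Qed.

Definition qg_one := pg_class (@pg_one P).
Definition qg_inv c := pg_class (pg_inv (pg_repr c)).
Definition qg_mul c d := pg_class (pg_mul (pg_repr c) (pg_repr d)).

Lemma qg_invE x : qg_inv (pg_class x) = pg_class (pg_inv x).
Proof. exact/pg_classE/pg_invE/pg_classK. Qed.

Lemma qg_mulE x y :
  qg_mul (pg_class x) (pg_class y) = pg_class (pg_mul x y).
Proof. by apply/pg_classE/pg_mulE; exact: pg_classK. Qed.

Fact qg_mulA : associative qg_mul.
Proof.
move=> a b c; rewrite -(pg_reprK a) -(pg_reprK b) -(pg_reprK c) !qg_mulE.
exact/pg_classE/pg_mulA.
Qed.

Fact qg_mul1g : left_id qg_one qg_mul.
Proof. by move=> a; rewrite -(pg_reprK a) qg_mulE; apply/pg_classE/pg_mul1. Qed.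

Fact qg_mulVg : left_inverse qg_one qg_inv qg_mul.
Proof.
by move=> a; rewrite -(pg_reprK a) qg_invE qg_mulE; apply/pg_classE/pg_mulV.
Qed.

Fact qg_mulgV : right_inverse qg_one qg_inv qg_mul.
Proof.
move=> a; rewrite -[LHS]qg_mul1g -(qg_mulVg (qg_inv a)) -qg_mulA.
by congr qg_mul; rewrite qg_mulA qg_mulVg qg_mul1g.
Qed.

Fact qg_mulg1 : right_id qg_one qg_mul.
Proof. by move=> a; rewrite -(qg_mulVg a) qg_mulA qg_mulgV qg_mul1g. Qed.

HB.instance Definition _ :=
  isGroup.Build quot_group qg_mulA qg_mul1g qg_mulg1 qg_mulVg qg_mulgV.

Lemma pg_classM x y : pg_class (pg_mul x y) = pg_class x * pg_class y.
Proof. by rewrite -qg_mulE. Qed.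

Lemma pg_classV x : pg_class (pg_inv x) = (pg_class x)^-1.
Proof. by rewrite -qg_invE. Qed.

Lemma pg_class1 : pg_class (pg_one P) = 1.
Proof. by []. Qed.

End QuotGroup.

Definition expgz (G : groupType) (x : G) (z : int) : G :=
  match z with Posz n => x ^+ n | Negz n => x ^- n.+1 end.

Definition isomorphic (G H : groupType) : Prop :=
  exists f : {multiplicative G -> H}, bijective f.

Record subgroup (G : groupType) := Subgroup {
  sg_set :> set G;
  sg_closed : group_closed (fun x => x \in sg_set)
}.

Section SubgroupType.
Variables (G : groupType) (H : subgroup G).

Definition subgroup_type : Type := {x : G | x \in sg_set H}.
HB.instance Definition _ := SubChoice.on subgroup_type.
HB.instance Definition _ :=
  SubChoice_isSubGroup.Build G _ subgroup_type (sg_closed H).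

End SubgroupType.

Section Basic.
Variable G : groupType.
Implicit Types H K : subgroup G.

Lemma sg_inj : injective (@sg_set G).
Proof.
move=> [A pA] [B pB] /= AB; case: _ / AB pB => pB.
by congr Subgroup; exact: Prop_irrelevance.
Qed.

Lemma sg1 H : sg_set H 1.
Proof. by case: (sg_closed H) => /set_mem. Qed.

Lemma sgF H x y : sg_set H x -> sg_set H y -> sg_set H (x / y).
Proof.
case: (sg_closed H) => _ h Hx Hy; apply/set_mem/h; rewrite -topredE;
  exact/mem_set.
Qed.

Lemma sgV H x : sg_set H x -> sg_set H x^-1.
Proof. by move=> Hx; rewrite -div1g; apply: sgF => //; exact: sg1. Qed.

Lemma sgM H x y : sg_set H x -> sg_set H y -> sg_set H (x * y).
Proof. by move=> Hx Hy; rewrite -[y]invgK; apply: sgF => //; exact: sgV. Qed.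

Fact mk_subgroup_subproof (A : set G) : A 1 ->
  (forall x y, A x -> A y -> A (x / y)) -> group_closed (fun x => x \in A).
Proof.
move=> A1 AF; split=> [|x y]; first exact: mem_set.
by move=> /set_mem Ax /set_mem Ay; apply: mem_set; apply: AF.
Qed.

Definition mk_subgroup (A : set G) (A1 : A 1)
    (AF : forall x y, A x -> A y -> A (x / y)) : subgroup G :=
  Subgroup (mk_subgroup_subproof A1 AF).

Definition normal_subgroup H : Prop :=
  forall x g, sg_set H x -> sg_set H (x ^ g).

Definition left_coset H (x : G) : set G := [set x * h | h in sg_set H].

Definition finite_index H : Prop := finite_set (range (left_coset H)).

Lemma left_cosetP H x y :
  left_coset H x = left_coset H y <-> sg_set H (x^-1 * y).
Proof.
split=> [e|Hxy].
  have : left_coset H y y by exists 1; rewrite ?mulg1//; exact: sg1.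
  by rewrite -e => -[h Hh <-]; rewrite mulKg.
apply/seteqP; split=> z [h Hh <-].
  exists (y^-1 * x * h); last by rewrite !mulgA mulgV mul1g.
  by apply: sgM => //; rewrite -[y^-1 * x]invgK invgM invgK; exact: sgV.
exists (x^-1 * y * h); last by rewrite !mulgA mulgV mul1g.
exact: sgM.
Qed.

Lemma finite_indexP H (T : Type) (c : G -> T) : finite_set (range c) ->
  (forall x y, c x = c y -> sg_set H (x^-1 * y)) -> finite_index H.
Proof.
move=> cfin cH; rewrite /finite_index.
have /choice[r rP] : forall t, exists x, range c t -> c x = t.
  move=> t; have [[x _ <-]|nt] := pselect (range c t); first by exists x.
  by exists 1.
apply: sub_finite_set (finite_image (left_coset H \o r) cfin) => _ [x _ <-].
exists (c x); first by exists x.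
by apply/left_cosetP/cH/rP; exists x.
Qed.

Definition full_subgroup : subgroup G :=
  @mk_subgroup setT I (fun _ _ _ _ => I).

Definition cap_subgroup H K : subgroup G :=
  @mk_subgroup (sg_set H `&` sg_set K) (conj (sg1 H) (sg1 K))
    (fun x y Ax Ay => conj (sgF Ax.1 Ay.1) (sgF Ax.2 Ay.2)).

Lemma finite_index_full : finite_index full_subgroup.
Proof. by apply: (@finite_indexP _ unit (fun=> tt)) => //; exact: finite_finset.
Qed.

Lemma finite_index_cap H K :
  finite_index H -> finite_index K -> finite_index (cap_subgroup H K).
Proof.
move=> fH fK; pose c x := (left_coset H x, left_coset K x).
apply: (@finite_indexP _ _ c) => [|x y [/left_cosetP ? /left_cosetP ?] //].
apply: sub_finite_set (finite_setX fH fK) => _ [x _ <-].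
by split; exists x.
Qed.

End Basic.

Section Presentation.
Variable X : choiceType.

(* The letter (x, true) stands for the generator x and (x, false) for its
   inverse. *)
Definition word := seq (X * bool).

Inductive word_eqv : word -> word -> Prop :=
| weqv_refl u : word_eqv u u
| weqv_sym u v : word_eqv u v -> word_eqv v u
| weqv_trans v u w : word_eqv u v -> word_eqv v w -> word_eqv u w
| weqv_cancel u x b v : word_eqv (u ++ (x, b) :: (x, ~~ b) :: v) (u ++ v).

Definition word_inv (w : word) : word := rev [seq (l.1, ~~ l.2) | l <- w].

Fact word_eqv_cat p s u v :
  word_eqv u v -> word_eqv (p ++ u ++ s) (p ++ v ++ s).
Proof.
elim=> [{}u|{}u {}v _|{}v {}u w _ uv _|{}u x b {}v].
- exact: weqv_refl.
- exact: weqv_sym.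
- exact: weqv_trans.
- by rewrite -!catA /= !(catA p); exact: weqv_cancel.
Qed.

Fact word_eqv_mul u u' v v' :
  word_eqv u u' -> word_eqv v v' -> word_eqv (u ++ v) (u' ++ v').
Proof.
move=> /(word_eqv_cat [::] v) /= uv /(word_eqv_cat u' [::]).
by rewrite !cats0; exact: weqv_trans.
Qed.

Fact word_eqv_inv u u' : word_eqv u u' -> word_eqv (word_inv u) (word_inv u').
Proof.
elim=> [{}u|{}u {}v _|{}v {}u w _ uv _|{}u x b {}v].
- exact: weqv_refl.
- exact: weqv_sym.
- exact: weqv_trans.
- rewrite /word_inv !map_cat !rev_cat /= !rev_cons -!cats1 -!catA /= negbK.
  exact: weqv_cancel.
Qed.

Fact word_mulA u v w : word_eqv (u ++ v ++ w) ((u ++ v) ++ w).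
Proof. by rewrite catA; exact: weqv_refl. Qed.

Fact word_mulV u : word_eqv (word_inv u ++ u) [::].
Proof.
elim: u => [|[x b] u IHu] /=; first exact: weqv_refl.
rewrite /word_inv /= rev_cons -cats1 -catA /=; apply: weqv_trans IHu.
by have := weqv_cancel (word_inv u) x (~~ b) u; rewrite negbK.
Qed.

Definition free_pregroup : pregroup :=
  @Pregroup word word_eqv [::] word_inv cat weqv_refl weqv_sym weqv_trans
    word_eqv_inv word_eqv_mul word_mulA weqv_refl word_mulV.

Definition free_group : groupType := quot_group free_pregroup.

Definition free_gen (x : X) : free_group :=
  pg_class ([:: (x, true)] : free_pregroup).

End Presentation.

Section NormalClosure.
Variable G : groupType.

Definition normal_closure (S : set G) : set G :=
  [set x | forall N : subgroup G,
     normal_subgroup N -> S `<=` sg_set N -> sg_set N x].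

Variable S : set G.
Local Notation N := (normal_closure S).

Lemma normal_closure1 : N 1.
Proof. by move=> M _ _; exact: sg1. Qed.

Lemma normal_closureM x y : N x -> N y -> N (x * y).
Proof. by move=> Nx Ny M nM SM; apply: sgM; [exact: Nx|exact: Ny]. Qed.

Lemma normal_closureV x : N x -> N x^-1.
Proof. by move=> Nx M nM SM; apply: sgV; exact: Nx. Qed.

Lemma normal_closureJ x g : N x -> N (x ^ g).
Proof. by move=> Nx M nM SM; exact: (nM x g (Nx M nM SM)). Qed.

Definition ncl_eqv (x y : G) : Prop := N (x^-1 * y).

Fact ncl_refl x : ncl_eqv x x.
Proof. by rewrite /ncl_eqv mulVg; exact: normal_closure1. Qed.

Fact ncl_sym x y : ncl_eqv x y -> ncl_eqv y x.
Proof. by move=> /normal_closureV; rewrite invgM invgK. Qed.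

Fact ncl_trans y x z : ncl_eqv x y -> ncl_eqv y z -> ncl_eqv x z.
Proof.
by move=> xy yz; have := normal_closureM xy yz; rewrite -mulgA mulVKg.
Qed.

Fact ncl_mulE x x' y y' :
  ncl_eqv x x' -> ncl_eqv y y' -> ncl_eqv (x * y) (x' * y').
Proof.
move=> xx yy; have := normal_closureM (normal_closureJ y xx) yy.
by rewrite /ncl_eqv conjgE invgM !mulgA mulgK.
Qed.

Fact ncl_invE x x' : ncl_eqv x x' -> ncl_eqv x^-1 x'^-1.
Proof.
move=> /ncl_sym /(normal_closureJ x'^-1).
by rewrite /ncl_eqv conjgE !invgK !mulgA mulgV mul1g.
Qed.

Fact ncl_mulA x y z : ncl_eqv (x * (y * z)) (x * y * z).
Proof. by rewrite mulgA; exact: ncl_refl. Qed.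

Fact ncl_mul1 x : ncl_eqv (1 * x) x.
Proof. by rewrite mul1g; exact: ncl_refl. Qed.

Fact ncl_mulV x : ncl_eqv (x^-1 * x) 1.
Proof. by rewrite mulVg; exact: ncl_refl. Qed.

Definition ncl_pregroup : pregroup :=
  @Pregroup G ncl_eqv 1 (fun x => x^-1) (fun x y => x * y) ncl_refl ncl_sym
    ncl_trans ncl_invE ncl_mulE ncl_mulA ncl_mul1 ncl_mulV.

End NormalClosure.

Definition presented_group (X : choiceType) (S : set (free_group X)) :
  groupType := quot_group (ncl_pregroup S).

Definition commutator (G : groupType) (x y : G) : G := x * y * x^-1 * y^-1.

Definition BS (m n : int) : groupType :=
  let a := free_gen (@Ordinal 2 0 isT) in
  let b := free_gen (@Ordinal 2 1 isT) in
  presented_group [set a * expgz b m * a^-1 * (expgz b n)^-1].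

Definition free2 : groupType := free_group 'I_2.

Definition Gamma2 : groupType :=
  let A := free_gen (@Ordinal 4 0 isT) in
  let B := free_gen (@Ordinal 4 1 isT) in
  let C := free_gen (@Ordinal 4 2 isT) in
  let D := free_gen (@Ordinal 4 3 isT) in
  presented_group [set commutator A B * commutator C D].

Definition commensurable (G1 G2 : groupType) : Prop :=
  exists (H1 : subgroup G1) (H2 : subgroup G2),
    [/\ finite_index H1, finite_index H2 &
        isomorphic (subgroup_type H1) (subgroup_type H2)].

Definition residually_finite (G : groupType) : Prop :=
  forall g : G, g <> 1 ->
    exists (Q : finGroupType) (f : {multiplicative G -> Q}), f g <> 1.

Section Image.
Variables (G H : groupType) (f : {multiplicative G -> H}).

Lemma mult1 : f 1 = 1.
Proof. by apply: (@mulgI _ (f 1)); rewrite -gmulfM !mulg1. Qed.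

Lemma multV x : f x^-1 = (f x)^-1.
Proof. by apply: (@mulgI _ (f x)); rewrite -gmulfM !mulgV mult1. Qed.

Fact image_subgroup_subproof x y : range f x -> range f y -> range f (x / y).
Proof.
by move=> [a _ <-] [b _ <-]; exists (a / b) => //; rewrite gmulfM multV.
Qed.

Definition image_subgroup : subgroup H :=
  mk_subgroup (ex_intro2 _ _ 1 I mult1) image_subgroup_subproof.

End Image.

Section Commensurator.
Variable G : groupType.

(* An isomorphism between two finite-index subgroups; the values of fi_map
   outside of fi_dom are junk, which comm_eqv below disregards. *)
Record fi_iso := FiIso {
  fi_dom : subgroup G;
  fi_cod : subgroup G;
  fi_map :> G -> G;
  fi_dom_index : finite_index fi_dom;
  fi_cod_index : finite_index fi_cod;
  fi_mapM : forall x y, sg_set fi_dom x -> sg_set fi_dom y ->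
    fi_map (x * y) = fi_map x * fi_map y;
  fi_bij : set_bij (sg_set fi_dom) (sg_set fi_cod) fi_map
}.

Definition comm_eqv (phi psi : fi_iso) : Prop :=
  exists K : subgroup G,
    [/\ finite_index K, sg_set K `<=` sg_set (fi_dom phi),
        sg_set K `<=` sg_set (fi_dom psi) &
        forall x, sg_set K x -> phi x = psi x].

Section OneIso.
Variable phi : fi_iso.
Local Notation D := (sg_set (fi_dom phi)).
Local Notation C := (sg_set (fi_cod phi)).

Fact fi_fun x : D x -> C (phi x).
Proof. by case: (fi_bij phi) => f _ _; exact: f. Qed.

Fact fi_inj x y : D x -> D y -> phi x = phi y -> x = y.
Proof.
by case: (fi_bij phi) => _ i _ Dx Dy; apply: i; exact: mem_set.
Qed.

Fact fi_map1 : phi 1 = 1.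
Proof. by apply: (@mulgI _ (phi 1)); rewrite -fi_mapM ?mulg1//; exact: sg1. Qed.

Fact fi_mapV x : D x -> phi x^-1 = (phi x)^-1.
Proof.
move=> Dx; apply: (@mulgI _ (phi x)); rewrite -fi_mapM ?mulgV ?fi_map1//.
exact: sgV.
Qed.

Fact fi_mapF x y : D x -> D y -> phi (x / y) = phi x / phi y.
Proof. by move=> Dx Dy; rewrite fi_mapM ?fi_mapV//; exact: sgV. Qed.

Definition fi_inv_map (y : G) : G := xget 1 [set x | D x /\ phi x = y].

Fact fi_inv_mapP y : C y -> D (fi_inv_map y) /\ phi (fi_inv_map y) = y.
Proof.
case: (fi_bij phi) => _ _ s Cy; rewrite /fi_inv_map.
by case: xgetP => [_ _ //|no]; have [x Dx e] := s _ Cy; case: (no x).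
Qed.

Fact fi_inv_mapK x : D x -> fi_inv_map (phi x) = x.
Proof.
move=> Dx; have [Dy] := fi_inv_mapP (fi_fun Dx); exact: fi_inj.
Qed.

Fact fi_inv_mapM x y : C x -> C y ->
  fi_inv_map (x * y) = fi_inv_map x * fi_inv_map y.
Proof.
move=> Cx Cy; have [Dx ex] := fi_inv_mapP Cx; have [Dy ey] := fi_inv_mapP Cy.
by rewrite -{1}ex -{1}ey -fi_mapM// fi_inv_mapK//; exact: sgM.
Qed.

Fact fi_inv_bij : set_bij C D fi_inv_map.
Proof.
split=> [y /fi_inv_mapP[]//|x y /set_mem Cx /set_mem Cy e|x Dx].
  have [_ ex] := fi_inv_mapP Cx; have [_ ey] := fi_inv_mapP Cy.
  by rewrite -ex -ey e.
by exists (phi x); [exact: fi_fun|exact: fi_inv_mapK].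
Qed.

Definition fi_inv : fi_iso :=
  FiIso (fi_cod_index phi) (fi_dom_index phi) fi_inv_mapM fi_inv_bij.

Section Image.
Variable K : subgroup G.

Fact fi_image1 : (phi @` (D `&` sg_set K)) 1.
Proof. by exists 1; [split; exact: sg1|exact: fi_map1]. Qed.

Fact fi_imageF x y : (phi @` (D `&` sg_set K)) x ->
  (phi @` (D `&` sg_set K)) y -> (phi @` (D `&` sg_set K)) (x / y).
Proof.
move=> [a [Da Ka] <-] [b [Db Kb] <-]; exists (a / b); last exact: fi_mapF.
by split; exact: sgF.
Qed.

Definition fi_image : subgroup G := mk_subgroup fi_image1 fi_imageF.

Fact fi_preimage1 : (D `&` phi @^-1` sg_set K) 1.
Proof. by split; [exact: sg1|rewrite /= fi_map1; exact: sg1]. Qed.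

Fact fi_preimageF x y : (D `&` phi @^-1` sg_set K) x ->
  (D `&` phi @^-1` sg_set K) y -> (D `&` phi @^-1` sg_set K) (x / y).
Proof.
move=> [/= Dx Kx] [/= Dy Ky]; split; first exact: sgF.
by rewrite /= fi_mapF//; exact: sgF.
Qed.

Definition fi_preimage : subgroup G := mk_subgroup fi_preimage1 fi_preimageF.

Fact fi_preimage_index : finite_index K -> finite_index fi_preimage.
Proof.
move=> fK.
have /choice[r rP] (A : set G) : exists x, A !=set0 -> A x.
  by have [[x Ax]|nA] := pselect (A !=set0); [exists x|exists 1].
have rxD x : D ((r (left_coset (fi_dom phi) x))^-1 * x).
  apply/left_cosetP.
  have /rP[h Dh <-] : left_coset (fi_dom phi) x !=set0.
    by exists x; exists 1; rewrite ?mulg1//; exact: sg1.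
  by apply/left_cosetP; rewrite invgM mulgVK; exact: sgV.
pose t x := (r (left_coset (fi_dom phi) x))^-1 * x.
pose c x := (left_coset (fi_dom phi) x, left_coset K (phi (t x))).
apply: (@finite_indexP _ _ _ c).
  apply: sub_finite_set (finite_setX (fi_dom_index phi) fK) => _ [x _ <-].
  by split; eexists.
move=> x y [e /left_cosetP].
have exy : (t x)^-1 * t y = x^-1 * y by rewrite /t e invgM invgK -mulgA mulVKg.
have Dtx : D (t x) by exact: rxD.
have Dty : D (t y) by exact: rxD.
rewrite -fi_mapV// -fi_mapM//; last exact: sgV.
rewrite exy => Kxy; split => //; rewrite -exy; apply: sgM => //; exact: sgV.
Qed.

End Image.
End OneIso.

Fact fi_image_index (phi : fi_iso) K :
  finite_index K -> finite_index (fi_image phi K).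
Proof.
move=> /(fi_preimage_index (fi_inv phi)); congr finite_index.
apply: sg_inj; apply/seteqP; split=> [y [/= Cy Ky]|_ [x [Dx Kx] <-]].
  by have [Dx e] := fi_inv_mapP Cy; exists (fi_inv_map phi y).
by split; [exact: fi_fun|rewrite /= fi_inv_mapK].
Qed.

Section Comp.
Variables phi psi : fi_iso.

Let D := fi_preimage psi (fi_dom phi).
Let C := fi_image phi (fi_cod psi).

Fact fi_comp_mapM x y : sg_set D x -> sg_set D y ->
  (phi \o psi) (x * y) = (phi \o psi) x * (phi \o psi) y.
Proof. by move=> [/= ? ?] [/= ? ?]; rewrite !fi_mapM. Qed.

Fact fi_comp_bij : set_bij (sg_set D) (sg_set C) (phi \o psi).
Proof.
split=> [x [/= Dx Dpx]|x y /set_mem[/= ? ?] /set_mem[/= ? ?] /= /fi_inj e|].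
- by exists (psi x) => //; split=> //; exact: fi_fun.
- by apply: (@fi_inj psi) => //; exact: e.
- move=> _ [z [Dz /fi_inv_mapP[Dx e]] <-].
  by exists (fi_inv_map psi z); rewrite /= e//; split=> //=; rewrite e.
Qed.

Definition fi_comp : fi_iso :=
  FiIso (fi_preimage_index psi (fi_dom_index phi))
    (fi_image_index phi (fi_cod_index psi)) fi_comp_mapM fi_comp_bij.

End Comp.

Fact fi_id_bij :
  set_bij (sg_set (full_subgroup G)) (sg_set (full_subgroup G)) idfun.
Proof. by split=> // x _; exists x. Qed.

Definition fi_id : fi_iso :=
  FiIso (@finite_index_full G) (@finite_index_full G)
    (fun _ _ _ _ => erefl) fi_id_bij.

Fact comm_refl phi : comm_eqv phi phi.
Proof. by exists (fi_dom phi); split=> //; exact: fi_dom_index. Qed.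

Fact comm_sym phi psi : comm_eqv phi psi -> comm_eqv psi phi.
Proof. by case=> K [fK K1 K2 e]; exists K; split=> // x /e. Qed.

Fact comm_trans psi phi chi :
  comm_eqv phi psi -> comm_eqv psi chi -> comm_eqv phi chi.
Proof.
move=> [K [fK K1 K2 e]] [L [fL L1 L2 e']]; exists (cap_subgroup K L).
split=> [|x [/K1//]|x [_ /L2//]|x [Kx Lx]]; first exact: finite_index_cap.
by rewrite e// e'.
Qed.

Fact comm_invE phi psi : comm_eqv phi psi -> comm_eqv (fi_inv phi) (fi_inv psi).
Proof.
move=> [K [fK K1 K2 e]]; exists (fi_image phi K).
split; first exact: fi_image_index.
- by move=> _ [x [Dx _] <-]; exact: fi_fun.
- by move=> _ [x [_ Kx] <-]; rewrite /= e//; apply/fi_fun/K2.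
- move=> _ [x [Dx Kx] <-] /=; rewrite fi_inv_mapK// e// fi_inv_mapK//.
  exact: K2.
Qed.

Fact comm_compE phi phi' psi psi' : comm_eqv phi phi' -> comm_eqv psi psi' ->
  comm_eqv (fi_comp phi psi) (fi_comp phi' psi').
Proof.
move=> [K [fK K1 K2 e]] [L [fL L1 L2 e']].
exists (cap_subgroup (fi_preimage psi K) L); split.
- by apply: finite_index_cap => //; exact: fi_preimage_index.
- by move=> x [[/= Dx Kx] _]; split=> //=; exact: K1.
- by move=> x [[/= Dx Kx] Lx]; split; [exact: L2|rewrite /= -e'//; exact: K2].
- by move=> x [[/= Dx Kx] Lx] /=; rewrite -e'// e.
Qed.

Fact comm_sub phi psi : sg_set (fi_dom phi) `<=` sg_set (fi_dom psi) ->
  (forall x, sg_set (fi_dom phi) x -> phi x = psi x) -> comm_eqv phi psi.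
Proof. by move=> s e; exists (fi_dom phi); split=> //; exact: fi_dom_index. Qed.

Fact comm_compA phi psi chi :
  comm_eqv (fi_comp phi (fi_comp psi chi)) (fi_comp (fi_comp phi psi) chi).
Proof. by apply: comm_sub => // x [[/= ? ?] ?]; split. Qed.

Fact comm_comp1 phi : comm_eqv (fi_comp fi_id phi) phi.
Proof. by apply: comm_sub => // x []. Qed.

Fact comm_compV phi : comm_eqv (fi_comp (fi_inv phi) phi) fi_id.
Proof. by apply: comm_sub => // x [/= Dx _]; exact: fi_inv_mapK. Qed.

Definition comm_pregroup : pregroup :=
  @Pregroup fi_iso comm_eqv fi_id fi_inv fi_comp comm_refl comm_sym comm_trans
    comm_invE comm_compE comm_compA comm_comp1 comm_compV.

Definition Comm : groupType := quot_group comm_pregroup.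

End Commensurator.

Section UnitInterval.
Local Open Scope ring_scope.
Variable R : realType.

Definition unit_itv : Type := set_type [set` `[0 : R, 1]].
HB.instance Definition _ := Topological.on unit_itv.

Fact unit_itv_clamp_subproof (t : R) :
  Order.max 0 (Order.min 1 t) \in [set` `[0 : R, 1]].
Proof.
apply: mem_set; rewrite /= in_itv /= le_max lexx /=.
by rewrite ge_max ler01 ge_min lexx.
Qed.

Definition clamp (t : R) : unit_itv := SigSub (unit_itv_clamp_subproof t).

Lemma unit_itvP (t : unit_itv) : 0 <= set_val t <= 1.
Proof. by have /set_mem := valP t; rewrite /= in_itv set_valE. Qed.

Lemma clampE (t : R) : 0 <= t <= 1 -> set_val (clamp t) = t.
Proof. by move=> /andP[t0 t1]; rewrite set_valE /= min_r// max_r. Qed.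

Lemma clampK (t : unit_itv) : clamp (set_val t) = t.
Proof. by apply: val_inj; rewrite [LHS]clampE ?unit_itvP. Qed.

Fact clamp01_neq : clamp 0 != clamp 1.
Proof.
apply/eqP => /(congr1 (fun t : unit_itv => set_val t)).
by rewrite !clampE ?lexx ?ler01// => /eqP; rewrite eq_sym oner_eq0.
Qed.

HB.instance Definition _ := isBiPointed.Build unit_itv clamp01_neq.

Lemma zeroE : (zero : unit_itv) = clamp 0. Proof. by []. Qed.
Lemma oneE : (one : unit_itv) = clamp 1. Proof. by []. Qed.

Lemma val_zero : set_val (zero : unit_itv) = 0.
Proof. by rewrite zeroE clampE// lexx ler01. Qed.

Lemma val_one : set_val (one : unit_itv) = 1.
Proof. by rewrite oneE clampE// lexx ler01. Qed.

Lemma unit_val_continuous : continuous (set_val : unit_itv -> R).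
Proof. exact: initial_continuous. Qed.

Lemma clamp_continuous : continuous clamp.
Proof.
apply/continuousP => A [B oB <-].
have c : continuous (fun t : R => Order.max 0 (Order.min 1 t)).
  move=> t; apply: continuous_max; first exact: cvg_cst.
  by apply: continuous_min; [exact: cvg_cst|exact: cvg_id].
by move/continuousP : c; apply.
Qed.

Lemma paste_continuous (Z T : topologicalType) (h : Z -> R) (c : R)
    (f g : Z -> T) : continuous h -> continuous f -> continuous g ->
  (forall z, h z = c -> f z = g z) ->
  continuous (fun z => if h z <= c then f z else g z).
Proof.
move=> ch cf cg fg z U; case: (ltgtP (h z) c) => [hz|hz|hz] zU.
- have /ch : nbhs (h z) [set t | t < c].
    by apply: open_nbhs_nbhs; split=> //; exact: open_lt.
  move: (cf z _ zU); rewrite !nbhs_simpl /=; apply: filterS2 => w /= fU hw.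
  by rewrite (ltW hw).
- have /ch : nbhs (h z) [set t | c < t].
    by apply: open_nbhs_nbhs; split=> //; exact: open_gt.
  move: (cg z _ zU); rewrite !nbhs_simpl /=; apply: filterS2 => w /= fU hw.
  by rewrite leNgt hw.
- have zV := zU; rewrite (fg _ hz) in zV.
  move: (cf z _ zU) (cg z _ zV); rewrite !nbhs_simpl /=.
  apply: filterS2 => w /= ? ?.
  by case: ifP.
Qed.

End UnitInterval.

Section FundamentalGroup.
Local Open Scope ring_scope.
Variables (R : realType) (T : topologicalType) (x : T).
Local Notation I := (unit_itv R).
Local Notation loop := {path I from x to x in T}.

(* H (t, s) is the point at time t of the loop at stage s. *)
Definition loop_homotopic (p q : loop) : Prop :=
  exists H : I * I -> T, continuous H /\
    [/\ forall t, H (t, zero) = p t, forall t, H (t, one) = q t,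
        forall s, H (zero, s) = x & forall s, H (one, s) = x].

Let val_cts (Z : topologicalType) (f : Z -> I) : continuous f ->
  continuous (fun z => set_val (f z) : R).
Proof.
by move=> cf z; apply: continuous_comp; [exact: cf|exact: unit_val_continuous].
Qed.

Let clamp_cts (Z : topologicalType) (f : Z -> R) : continuous f ->
  continuous (fun z => clamp (f z)).
Proof.
by move=> cf z; apply: continuous_comp; [exact: cf|exact: clamp_continuous].
Qed.

Let comp_cts (Z U V : topologicalType) (f : Z -> U) (g : U -> V) :
  continuous f -> continuous g -> continuous (fun z => g (f z)).
Proof. by move=> cf cg z; apply: continuous_comp; [exact: cf|exact: cg]. Qed.

Let pair_cts (Z U V : topologicalType) (f : Z -> U) (g : Z -> V) :
  continuous f -> continuous g -> continuous (fun z => (f z, g z)).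
Proof. by move=> cf cg z; apply: cvg_pair; [exact: cf|exact: cg]. Qed.

Let fst_cts : continuous (fst : I * I -> I).
Proof. by move=> z; exact: cvg_fst. Qed.

Let snd_cts : continuous (snd : I * I -> I).
Proof. by move=> z; exact: cvg_snd. Qed.

Let id_cts : continuous (id : I -> I).
Proof. by move=> z; exact: cvg_id. Qed.

Let affine_cts (Z : topologicalType) (f : Z -> R) (a b : R) : continuous f ->
  continuous (fun z => a * f z + b).
Proof.
move=> cf z; apply: cvgD; last exact: cvg_cst.
by apply: cvgM; [exact: cvg_cst|exact: cf].
Qed.

Let min_cts (Z : topologicalType) (f g : Z -> R) : continuous f ->
  continuous g -> continuous (fun z => Order.min (f z) (g z)).
Proof. by move=> cf cg z; exact: (continuous_min (cf z) (cg z)). Qed.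

Let max_cts (Z : topologicalType) (f g : Z -> R) : continuous f ->
  continuous g -> continuous (fun z => Order.max (f z) (g z)).
Proof. by move=> cf cg z; exact: (continuous_max (cf z) (cg z)). Qed.

Let dbl1_cts (Z : topologicalType) (f : Z -> I) : continuous f ->
  continuous (fun z => clamp (2 * (set_val (f z) : R))).
Proof.
move=> cf; apply: clamp_cts => z; apply: cvgM; first exact: cvg_cst.
exact: val_cts.
Qed.

Let dbl2_cts (Z : topologicalType) (f : Z -> I) : continuous f ->
  continuous (fun z => clamp (2 * (set_val (f z) : R) - 1)).
Proof. by move=> cf; apply: clamp_cts; apply: affine_cts; exact: val_cts. Qed.

Let opp_cts (Z : topologicalType) (f : Z -> I) : continuous f ->
  continuous (fun z => clamp (1 - (set_val (f z) : R))).
Proof.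
move=> cf; apply: clamp_cts => z; apply: cvgB; first exact: cvg_cst.
exact: val_cts.
Qed.

Let two_half (t : R) : t = 2^-1 -> 2 * t = 1 /\ 2 * t - 1 = 0.
Proof. by move=> ->; split; lra. Qed.

Section Concat.
Variables p q : loop.

Definition concat_fun (t : I) : T :=
  if set_val t <= 2^-1 :> R then p (clamp (2 * set_val t))
  else q (clamp (2 * set_val t - 1)).

Fact concat_cts : continuous concat_fun.
Proof.
apply: paste_continuous.
- exact: unit_val_continuous.
- by apply: comp_cts; [exact: dbl1_cts|exact: cts_fun].
- by apply: comp_cts; [exact: dbl2_cts|exact: cts_fun].
- by move=> t /two_half[-> ->]; rewrite -zeroE -oneE path_zero path_one.
Qed.

Fact concat_zero : concat_fun zero = x.
Proof.
rewrite /concat_fun val_zero invr_ge0 ler0n mulr0 -zeroE; exact: path_zero.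
Qed.

Fact concat_one : concat_fun one = x.
Proof.
rewrite /concat_fun val_one.
have -> : ((1 : R) <= 2^-1) = false by apply/negbTE; rewrite -ltNge; lra.
have -> : 2 * 1 - 1 = 1 :> R by lra.
rewrite -oneE; exact: path_one.
Qed.

Definition concat : loop := mk_path concat_cts concat_zero concat_one.

Definition reverse_fun (t : I) : T := p (clamp (1 - set_val t)).

Fact reverse_cts : continuous reverse_fun.
Proof. by apply: comp_cts; [exact: opp_cts|exact: cts_fun]. Qed.

Fact reverse_zero : reverse_fun zero = x.
Proof. rewrite /reverse_fun val_zero subr0 -oneE; exact: path_one. Qed.

Fact reverse_one : reverse_fun one = x.
Proof. rewrite /reverse_fun val_one subrr -zeroE; exact: path_zero. Qed.

Definition reverse : loop := mk_path reverse_cts reverse_zero reverse_one.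

End Concat.

Definition cst_loop : loop :=
  mk_path (@cst_continuous I T x) (erefl x) (erefl x).

Lemma concatE p q t : concat p q t =
  if set_val t <= 2^-1 :> R then p (clamp (2 * set_val t))
  else q (clamp (2 * set_val t - 1)).
Proof. by []. Qed.

Lemma reverseE p t : reverse p t = p (clamp (1 - set_val t)).
Proof. by []. Qed.

Fact loop_refl p : loop_homotopic p p.
Proof.
exists (fun z => p z.1); split; first by apply: comp_cts => //; exact: cts_fun.
by split=> // s /=; [exact: path_zero|exact: path_one].
Qed.

Fact loop_sym p q : loop_homotopic p q -> loop_homotopic q p.
Proof.
move=> [H [cH [H0 H1 Hz Ho]]].
exists (fun z => H (z.1, clamp (1 - (set_val z.2 : R)))); split.
  by apply: comp_cts cH; apply: pair_cts => //; exact: opp_cts.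
by split=> // t; rewrite /= ?val_zero ?val_one ?subr0 ?subrr -?zeroE -?oneE.
Qed.

Fact loop_trans q p r :
  loop_homotopic p q -> loop_homotopic q r -> loop_homotopic p r.
Proof.
move=> [H [cH [H0 H1 Hz Ho]]] [K [cK [K0 K1 Kz Ko]]].
exists (fun z => if set_val z.2 <= 2^-1 :> R
  then H (z.1, clamp (2 * set_val z.2))
  else K (z.1, clamp (2 * set_val z.2 - 1))); split.
  apply: paste_continuous.
  - exact: val_cts.
  - by apply: comp_cts cH; apply: pair_cts => //; exact: dbl1_cts.
  - by apply: comp_cts cK; apply: pair_cts => //; exact: dbl2_cts.
  - by move=> z /two_half[-> ->]; rewrite -zeroE -oneE H1 K0.
split=> [t|t|s|s] /=.
- by rewrite val_zero invr_ge0 ler0n mulr0 -zeroE.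
- rewrite val_one; have -> : ((1 : R) <= 2^-1) = false.
    by apply/negbTE; rewrite -ltNge; lra.
  by have -> : 2 * 1 - 1 = 1 :> R by lra.
- by rewrite Hz Kz if_same.
- by rewrite Ho Ko if_same.
Qed.

Fact loop_concatE p p' q q' : loop_homotopic p p' -> loop_homotopic q q' ->
  loop_homotopic (concat p q) (concat p' q').
Proof.
move=> [H [cH [H0 H1 Hz Ho]]] [K [cK [K0 K1 Kz Ko]]].
exists (fun z => if set_val z.1 <= 2^-1 :> R
  then H (clamp (2 * set_val z.1), z.2)
  else K (clamp (2 * set_val z.1 - 1), z.2)); split.
  apply: paste_continuous.
  - exact: val_cts.
  - by apply: comp_cts cH; apply: pair_cts => //; exact: dbl1_cts.
  - by apply: comp_cts cK; apply: pair_cts => //; exact: dbl2_cts.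
  - by move=> z /two_half[-> ->]; rewrite -zeroE -oneE Ho Kz.
split=> [t|t|s|s] /=.
- by rewrite H0 K0.
- by rewrite H1 K1.
- by rewrite val_zero invr_ge0 ler0n mulr0 -zeroE.
- rewrite val_one; have -> : ((1 : R) <= 2^-1) = false.
    by apply/negbTE; rewrite -ltNge; lra.
  by have -> : 2 * 1 - 1 = 1 :> R by lra.
Qed.

Fact loop_reverseE p p' :
  loop_homotopic p p' -> loop_homotopic (reverse p) (reverse p').
Proof.
move=> [H [cH [H0 H1 Hz Ho]]].
exists (fun z => H (clamp (1 - (set_val z.1 : R)), z.2)); split.
  by apply: comp_cts cH; apply: pair_cts => //; exact: opp_cts.
by split=> [t|t|s|s] /=;
  rewrite ?H0 ?H1// ?val_zero ?val_one ?subr0 ?subrr -?zeroE -?oneE.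
Qed.

Fact loop_reparam (b p q : loop) (f g : I -> R) :
  continuous f -> continuous g -> f zero = g zero -> f one = g one ->
  (forall t, p t = b (clamp (f t))) -> (forall t, q t = b (clamp (g t))) ->
  loop_homotopic p q.
Proof.
move=> cf cg e0 e1 pE qE.
exists (fun z => b (clamp (f z.1 + set_val z.2 * (g z.1 - f z.1)))); split.
  apply: comp_cts; last exact: cts_fun.
  apply: clamp_cts => z; apply: cvgD; first exact: (comp_cts fst_cts cf).
  apply: cvgM; first exact: (val_cts snd_cts).
  by apply: cvgB; [exact: (comp_cts fst_cts cg)|exact: (comp_cts fst_cts cf)].
split=> [t|t|s|s] /=.
- by rewrite val_zero mul0r addr0 pE.
- by rewrite val_one mul1r subrKC qE.
- by rewrite e0 subrr mulr0 addr0 -qE path_zero.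
- by rewrite e1 subrr mulr0 addr0 -qE path_one.
Qed.

Fact loop_mulA p q r :
  loop_homotopic (concat p (concat q r)) (concat (concat p q) r).
Proof.
pose g (t : I) : R := Order.min (2 * set_val t + 0)
  (Order.min (1 * set_val t + 4^-1) (2^-1 * set_val t + 2^-1)).
apply: (@loop_reparam (concat p (concat q r)) _ _ (fun t => set_val t) g).
- exact: unit_val_continuous.
- apply: min_cts; first by apply: affine_cts; exact: unit_val_continuous.
  by apply: min_cts; apply: affine_cts; exact: unit_val_continuous.
- by rewrite /g val_zero !minEle; case: (leP (_ + 4^-1)) => ?;
    case: leP => ?; lra.
- by rewrite /g val_one !minEle; case: (leP (_ + 4^-1)) => ?;
    case: leP => ?; lra.
- by move=> t; rewrite clampK.
move=> t; have /andP[t0 t1] := unit_itvP t.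
rewrite !concatE.
have [t2|t2] := leP (set_val t) 2^-1.
  rewrite [set_val (clamp (2 * _))]clampE; last by apply/andP; split; lra.
  have [t4|t4] := leP (2 * set_val t) 2^-1.
    have -> : g t = 2 * set_val t.
      by rewrite /g !minEle; case: (leP (_ + 4^-1)) => ?; case: leP => ?; lra.
    by rewrite clampE ?t4//; apply/andP; split; lra.
  have -> : g t = set_val t + 4^-1.
    by rewrite /g !minEle; case: (leP (_ + 4^-1)) => ?; case: leP => ?; lra.
  rewrite clampE; last by apply/andP; split; lra.
  rewrite ifF; last by apply/negbTE; rewrite -ltNge; lra.
  rewrite clampE; last by apply/andP; split; lra.
  rewrite ifT; last by lra.
  by congr (q (clamp _)); lra.
have -> : g t = 2^-1 * set_val t + 2^-1.
  by rewrite /g !minEle; case: (leP (_ + 4^-1)) => ?; case: leP => ?; lra.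
rewrite clampE; last by apply/andP; split; lra.
rewrite ifF; last by apply/negbTE; rewrite -ltNge; lra.
rewrite clampE; last by apply/andP; split; lra.
rewrite ifF; last by apply/negbTE; rewrite -ltNge; lra.
by congr (r (clamp _)); lra.
Qed.

Fact loop_mul1 p : loop_homotopic (concat cst_loop p) p.
Proof.
pose f (t : I) : R := Order.max 0 (2 * set_val t - 1).
apply: (@loop_reparam p _ _ f (fun t => set_val t)).
- apply: max_cts; first exact: cst_continuous.
  by apply: affine_cts; exact: unit_val_continuous.
- exact: unit_val_continuous.
- by rewrite /f val_zero maxEle; case: leP => ?; lra.
- by rewrite /f val_one maxEle; case: leP => ?; lra.
- move=> t; rewrite concatE /f.
  have [t2|t2] := leP (set_val t) 2^-1; last by rewrite max_r//; lra.
  by rewrite max_l -?zeroE ?path_zero//; lra.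
- by move=> t; rewrite clampK.
Qed.

Fact loop_mulV p : loop_homotopic (concat (reverse p) p) cst_loop.
Proof.
pose f (t : I) : R := Order.max (-2 * set_val t + 1) (2 * set_val t - 1).
apply: (@loop_reparam p _ _ f (fun=> 1)).
- by apply: max_cts; apply: affine_cts;
    exact: unit_val_continuous.
- exact: cst_continuous.
- by rewrite /f val_zero maxEle; case: leP => ?; lra.
- by rewrite /f val_one maxEle; case: leP => ?; lra.
- move=> t; have /andP[t0 t1] := unit_itvP t.
  rewrite concatE /f.
  have [t2|t2] := leP (set_val t) 2^-1; last by rewrite max_r//; lra.
  rewrite max_l; last by lra.
  rewrite reverseE clampE; last by apply/andP; split; lra.
  by congr (p (clamp _)); lra.
- by move=> t; rewrite -oneE path_one.
Qed.

Definition pi1_pregroup : pregroup :=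
  @Pregroup loop loop_homotopic cst_loop reverse concat loop_refl loop_sym
    loop_trans loop_reverseE loop_concatE loop_mulA loop_mul1 loop_mulV.

Definition pi1 : groupType := quot_group pi1_pregroup.

End FundamentalGroup.

Definition homeomorphic (X Y : topologicalType) : Prop :=
  exists (f : X -> Y) (g : Y -> X),
    [/\ continuous f, continuous g, cancel f g & cancel g f].

Section Surfaces.
Local Open Scope ring_scope.
Variable R : realType.

Definition half_plane : set (R * R) := [set p | 0 <= p.2].

Definition locally_half_plane (M : topologicalType) (x : M) : Prop :=
  exists (U : set M) (V : set (set_type half_plane)),
    [/\ open U, U x, open V & homeomorphic (set_type U) (set_type V)].

Definition interior_point (M : topologicalType) (x : M) : Prop :=
  exists (U : set M) (V : set (R * R)),
    [/\ open U, U x, open V & homeomorphic (set_type U) (set_type V)].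

Definition connected_surface (M : topologicalType) : Prop :=
  [/\ hausdorff_space M, @second_countable M, connected [set: M] &
      forall x : M, locally_half_plane x].

(* Finite genus and finitely many punctures and boundary components: S is a
   compact surface, possibly with boundary, with finitely many interior points
   removed. *)
Definition finite_type_surface (S : topologicalType) : Prop :=
  connected_surface S /\
  exists (M : topologicalType) (P : set M),
    [/\ connected_surface M, compact [set: M], finite_set P,
        P `<=` [set x | interior_point x] & homeomorphic S (set_type (~` P))].

Definition surface_group (G : groupType) : Prop :=
  exists (S : topologicalType) (x : S),
    finite_type_surface S /\ isomorphic G (pi1 R x).

End Surfaces.

(* Main.v *)
Require Import Defs.
From HB Require Import structures.
From mathcomp Require Import all_boot all_order all_algebra fingroup.
From mathcomp Require Import all_classical all_reals all_analysis.
From mathcomp Require Import zify ring lra cyclic.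

(* Comm is a commensurability invariant, so Gamma may be replaced by
   G = free2 or G = Gamma2. Both have generators A, B and further generators c
   with [A, B] = k a word in c. Let H be the kernel of the map G -> Z/n with
   A |-> 1 and the other generators |-> 0, and H' the analogous subgroup with
   A and B exchanged. The n-fold cyclic covers of the surface belonging to H
   and H' are homeomorphic: in both, the torus carrying A and B unrolls to a
   torus with n copies of the rest of the surface attached. This gives an
   isomorphism phi_n : H -> H' with
     A^n |-> A,  B |-> B^n,  A^i c A^-i |-> B^(n-1-i) c B^-(n-1-i)  (i < n).
   In Comm(G) it conjugates the inner automorphism of B to that of B^n; the
   latter has infinite order, which forces BS(1,n) -> Comm(G) to be injective.
   For BS(2,3) take a |-> phi_3 phi_2^-1 and b |-> B. The commutator of
   a b a^-1 and b dies in every finite quotient of BS(2,3), but not in Comm(G):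
   the square root phi_2^-1 B phi_2 and the cube root phi_3^-1 B phi_3 of B do
   not commute, as one sees by applying them to k in both orders and mapping G
   to the affine group of rat by A = (v |-> 2v), B = (v |-> v + 1). *)

Set Implicit Arguments.
Unset Strict Implicit.
Unset Printing Implicit Defensive.

(* [fingroup] shadows the name. *)
Local Notation commutator := Defs.commutator.

(** * Evaluation of words in a group *)

Section WordEvaluation.
Local Open Scope group_scope.

Definition eval_letter (M : groupType) (X : Type) (d : X -> M) (l : X * bool) :
  M := if l.2 then d l.1 else (d l.1)^-1.

Definition eval_word (M : groupType) (X : Type) (d : X -> M)
    (w : seq (X * bool)) : M :=
  foldr (fun l x => eval_letter d l * x) 1 w.

Lemma eval_word_cat (M : groupType) (X : Type) (d : X -> M) u v :
  eval_word d (u ++ v) = eval_word d u * eval_word d v.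
Proof. by elim: u => [|l u IH] /=; rewrite ?mul1g// IH mulgA. Qed.

Lemma eval_word_inv (M : groupType) (X : choiceType) (d : X -> M) (w : word X) :
  eval_word d (word_inv w) = (eval_word d w)^-1.
Proof.
rewrite /word_inv; elim: w => [|[x b] w IH] /=; first by rewrite invg1.
rewrite rev_cons -cats1 eval_word_cat IH /= mulg1 invgM; congr (_ * _).
by rewrite /eval_letter; case: b; rewrite //= invgK.
Qed.

Lemma eval_word_morph (M N : groupType) (f : {multiplicative M -> N})
    (X : Type) (d : X -> M) (w : seq (X * bool)) :
  f (eval_word d w) = eval_word (f \o d) w.
Proof.
elim: w => [|[x b] w IH] /=; first exact: mult1.
by rewrite gmulfM IH; congr (_ * _); case: b; rewrite // [LHS]multV.
Qed.

Lemma eval_word_eqv (M : groupType) (X : choiceType) (d : X -> M) u v :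
  word_eqv u v -> eval_word d u = eval_word d v.
Proof.
elim=> [//|{}u {}v _ ->//|{}v {}u w _ -> _ ->//|{}u x b {}v].
rewrite !eval_word_cat /=; congr (_ * _).
by case: b; rewrite /eval_letter /= ?mulKg ?mulVKg.
Qed.

End WordEvaluation.

(** * Universal properties of free and presented groups *)

Section UniversalProperties.
Local Open Scope group_scope.
Local Open Scope classical_set_scope.

Lemma free_group_lift (X : choiceType) (M : groupType) (d : X -> M) :
  exists f : {multiplicative (free_group X) -> M},
    forall x, f (free_gen x) = d x.
Proof.
pose f (u : free_group X) : M := eval_word d (pg_repr u).
have fE (u : free_pregroup X) : f (pg_class u) = eval_word d u.
  apply: eval_word_eqv; exact: (@pg_classK (free_pregroup X)).
have fM : {morph f : u v / u * v}.
  by move=> u v; rewrite -{1}(pg_reprK u) -{1}(pg_reprK v) -pg_classM fE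
    [LHS]eval_word_cat.
pose F : {multiplicative (free_group X) -> M} :=
  HB.pack f (isMultiplicative.Build _ _ f fM).
by exists F => x; rewrite /= [LHS]fE /= mulg1.
Qed.

Lemma free_group_eval (X : choiceType) (u : free_pregroup X) :
  pg_class u = eval_word (@free_gen X) u.
Proof.
elim: u => [//|[x b] u IH] /=.
rewrite -IH -[(x, b) :: u]/(pg_mul ([:: (x, b)] : free_pregroup X) u) pg_classM.
by congr (_ * _); case: b; rewrite // /eval_letter /= -pg_classV.
Qed.

Lemma sg_eval_word (G : groupType) (S : subgroup G) (X : Type) (d : X -> G) w :
  (forall x, sg_set S (d x)) -> sg_set S (eval_word d w).
Proof.
move=> Sd; elim: w => [|[x b] w IH] /=; first exact: sg1.
apply: sgM => //; case: b; rewrite /eval_letter //=; exact: sgV.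
Qed.

Lemma free_group_ind (X : choiceType) (S : subgroup (free_group X)) :
  (forall x, sg_set S (free_gen x)) -> forall u, sg_set S u.
Proof.
by move=> Sg u; rewrite -(pg_reprK u) free_group_eval; exact: sg_eval_word.
Qed.

Definition ker_subgroup (G M : groupType) (f : {multiplicative G -> M}) :
  subgroup G.
Proof.
apply: (@mk_subgroup G [set x | f x = 1]); first exact: mult1.
by move=> x y /= fx fy; rewrite gmulfM multV fx fy invg1 mulg1.
Defined.

Lemma presented_classM (X : choiceType) (S : set (free_group X))
    (u v : free_group X) :
  pg_class (u * v : ncl_pregroup S) =
  (pg_class (u : ncl_pregroup S) : presented_group S) *
  pg_class (v : ncl_pregroup S).
Proof. exact: (@pg_classM (ncl_pregroup S)). Qed.

Definition presented_proj (X : choiceType) (S : set (free_group X)) :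
    {multiplicative (free_group X) -> presented_group S} :=
  let p := fun u : free_group X =>
    pg_class (u : ncl_pregroup S) : presented_group S in
  HB.pack p (isMultiplicative.Build _ _ p (@presented_classM X S)).

Lemma presented_proj_rel (X : choiceType) (S : set (free_group X)) u :
  S u -> presented_proj S u = 1.
Proof.
move=> Su; rewrite /= -pg_class1; apply/pg_classE/ncl_sym => N _ SN /=.
by rewrite invg1 mul1g; exact: SN.
Qed.

Lemma presented_group_lift (X : choiceType) (S : set (free_group X))
    (M : groupType) (f : {multiplicative (free_group X) -> M}) :
  (forall u, S u -> f u = 1) ->
  exists F : {multiplicative (presented_group S) -> M},
    forall u, F (presented_proj S u) = f u.
Proof.
move=> fS.
pose h (c : presented_group S) : M := f (pg_repr c).
have hE u : h (presented_proj S u) = f u.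
  (* The chosen representative differs from [u] by an element of every normal subgroup containing
     [S]; the kernel of [f] is one of these. *)
  have /(_ (ker_subgroup f)) := @pg_classK (ncl_pregroup S) u.
  move=> /= kerf; apply/(@mulgI _ (f (pg_repr (presented_proj S u)))^-1).
  rewrite mulVg -multV -gmulfM; apply/esym/kerf => [x g /= fx|v /fS //].
  by rewrite conjgE !gmulfM fx mul1g multV mulVg.
have hM : {morph h : u v / u * v}.
  move=> u v; have e (w : presented_group S) : w = presented_proj S (pg_repr w).
    by rewrite /= pg_reprK.
  by rewrite {1}(e u) {1}(e v) -gmulfM hE gmulfM.
pose F : {multiplicative (presented_group S) -> M} :=
  HB.pack h (isMultiplicative.Build _ _ h hM).
by exists F => u; exact: hE.
Qed.

Lemma presented_group_ind (X : choiceType) (S : set (free_group X))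
    (T : subgroup (presented_group S)) :
  (forall x, sg_set T (presented_proj S (free_gen x))) -> forall u, sg_set T u.
Proof.
move=> Tg u; rewrite -(pg_reprK u).
pose U : set (free_group X) := presented_proj S @^-1` sg_set T.
have U1 : U 1 by rewrite /U /preimage /mkset mult1; exact: sg1.
have UF x y : U x -> U y -> U (x / y).
  by rewrite /U /preimage /mkset gmulfM multV; exact: sgF.
exact: (@free_group_ind X (mk_subgroup U1 UF)).
Qed.

End UniversalProperties.

(** * Groups with a handle, and the two examples *)

Section Handle.
Local Open Scope group_scope.

(* [G] is the amalgam of the free group on [A, B] with another group along
   [commutator A B = k], where [k] is a word in the generators [c j] of the
   other factor: a surface group in which [A, B] generate a handle. *)
Record handle (G : groupType) (A B : G) (J : choiceType) (c : J -> G)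
    (w : word J) : Prop := Handle {
  handle_rel : commutator A B = eval_word c w;
  handle_lift : forall (M : groupType) (a b : M) (d : J -> M),
    commutator a b = eval_word d w ->
    exists f : {multiplicative G -> M},
      [/\ f A = a, f B = b & forall j, f (c j) = d j];
  handle_ind : forall S : subgroup G, sg_set S A -> sg_set S B ->
    (forall j, sg_set S (c j)) -> forall x, sg_set S x }.

Lemma commutatorV (G : groupType) (a b : G) :
  (commutator a b)^-1 = commutator b a.
Proof. by rewrite /commutator !invgM !invgK !mulgA. Qed.

Lemma commutator_morph (G M : groupType) (f : {multiplicative G -> M}) a b :
  f (commutator a b) = commutator (f a) (f b).
Proof. by rewrite /commutator !gmulfM !multV. Qed.

(** Exchanging the handle generators inverts [k]. The rolling map built with the roles exchanged
    will be the inverse of the original one. *)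
Lemma handle_swap (G : groupType) (A B : G) (J : choiceType) (c : J -> G) w :
  handle A B c w -> handle B A c (word_inv w).
Proof.
move=> [rel lift ind]; split=> [|M a b d e|S SB SA Sc].
- by rewrite -commutatorV rel eval_word_inv.
- have [|f [fA fB fc]] := lift M b a d; last by exists f.
  by rewrite -commutatorV e eval_word_inv invgK.
- exact: ind.
Qed.

Definition commutator_word (J : choiceType) (x y : J) : word J :=
  [:: (x, true); (y, true); (x, false); (y, false)].

Lemma eval_commutator_word (M : groupType) (J : choiceType) (d : J -> M) x y :
  eval_word d (commutator_word x y) = commutator (d x) (d y).
Proof. by rewrite /= /eval_letter /= mulg1 /commutator !mulgA. Qed.

(** The other factor is infinite cyclic, generated by the commutator of [A] and [B] itself, so [w]
    is a single letter. *)
Lemma free2_handle : exists (A B : free2) (c : unit -> free2),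
  handle A B c [:: (tt, true)].
Proof.
pose A : free2 := free_gen (@Ordinal 2 0 isT).
pose B : free2 := free_gen (@Ordinal 2 1 isT).
exists A, B, (fun=> commutator A B); split=> [|M a b d e|S SA SB Sc x].
- by rewrite /= /eval_letter /= mulg1.
- have [f fE] := free_group_lift (fun i : 'I_2 => if val i is 0 then a else b).
  exists f; split; rewrite ?fE // => -[].
  by rewrite commutator_morph !fE /= e /= /eval_letter /= mulg1.
- apply: free_group_ind => -[[|[|//]] lt2].
    by rewrite (_ : Ordinal _ = @Ordinal 2 0 isT)//; exact: val_inj.
  by rewrite (_ : Ordinal _ = @Ordinal 2 1 isT)//; exact: val_inj.
Qed.

(** The surface relation reads [[A, B] = [D, C]]; [true] indexes [D] and [false] indexes [C]. *)
Lemma Gamma2_handle : exists (A B : Gamma2) (c : bool -> Gamma2),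
  handle A B c (commutator_word true false).
Proof.
rewrite /Gamma2; set S := (X in presented_group X).
pose g i : presented_group S := presented_proj S (free_gen i).
pose A := g (@Ordinal 4 0 isT); pose B := g (@Ordinal 4 1 isT).
pose C := g (@Ordinal 4 2 isT); pose D := g (@Ordinal 4 3 isT).
exists A, B, (fun b => if b then D else C); split=> [|M a b d e|T TA TB Tc].
- rewrite eval_commutator_word -[RHS]commutatorV; apply: divg1_eq.
  by rewrite invgK -!commutator_morph -gmulfM; exact: presented_proj_rel.
- have [f fE] := free_group_lift (fun i : 'I_4 => match val i with
    | 0 => a | 1 => b | 2 => d false | _ => d true end).
  have [|F FE] := @presented_group_lift _ S _ f.
    move=> _ ->; rewrite gmulfM !commutator_morph !fE /= e eval_commutator_word.
    by rewrite -(commutatorV (d false)) mulVg.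
  by exists F; rewrite /A /B /C /D /g; split=> [||[]]; rewrite FE fE.
- apply: presented_group_ind => -[[|[|[|[|//]]]] lt4].
  + by rewrite (_ : Ordinal _ = @Ordinal 4 0 isT)//; exact: val_inj.
  + by rewrite (_ : Ordinal _ = @Ordinal 4 1 isT)//; exact: val_inj.
  + rewrite (_ : Ordinal _ = @Ordinal 4 2 isT); first exact: (Tc false).
    exact: val_inj.
  + rewrite (_ : Ordinal _ = @Ordinal 4 3 isT); first exact: (Tc true).
    exact: val_inj.
Qed.

(* Then the free group on the handle generators [A, B] is a retract of the
   handle group. *)
Definition retractable (J : choiceType) (w : word J) : Prop :=
  forall (M : groupType) (a b : M), exists d : J -> M,
    commutator a b = eval_word d w.

End Handle.

(** * Permutation groups of arbitrary types, used as targets of the universal property *)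

Section Bijections.
Variable X : Type.

Record bijection := Bijection {
  bij_fun :> X -> X;
  bij_inv : X -> X;
  bij_funK : cancel bij_fun bij_inv;
  bij_invK : cancel bij_inv bij_fun
}.

HB.instance Definition _ := gen_eqMixin bijection.
HB.instance Definition _ := gen_choiceMixin bijection.

Lemma bijectionP (f g : bijection) : f =1 g -> f = g.
Proof.
case: f g => [f f' fK f'K] [g g' gK g'K] /= /funext fg.
move: fK f'K; rewrite {}fg => fK f'K.
have e : f' = g' by apply/funext => x; rewrite -{1}(g'K x) fK.
by move: fK f'K; rewrite e => fK f'K; congr Bijection; exact: Prop_irrelevance.
Qed.

Definition bijection_one : bijection := @Bijection id id (frefl id) (frefl id).
Definition bijection_inv (f : bijection) : bijection :=
  Bijection (@bij_invK f) (@bij_funK f).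
Definition bijection_mul (f g : bijection) : bijection :=
  Bijection (can_comp (@bij_funK f) (@bij_funK g))
    (can_comp (@bij_invK g) (@bij_invK f)).

Fact bijection_mulA : associative bijection_mul.
Proof. by move=> f g h; exact: bijectionP. Qed.
Fact bijection_mul1g : left_id bijection_one bijection_mul.
Proof. by move=> f; exact: bijectionP. Qed.
Fact bijection_mulg1 : right_id bijection_one bijection_mul.
Proof. by move=> f; exact: bijectionP. Qed.
Fact bijection_mulVg : left_inverse bijection_one bijection_inv bijection_mul.
Proof. by move=> f; apply: bijectionP => x /=; exact: bij_funK. Qed.
Fact bijection_mulgV : right_inverse bijection_one bijection_inv bijection_mul.
Proof. by move=> f; apply: bijectionP => x /=; exact: bij_invK. Qed.

HB.instance Definition _ := isGroup.Build bijection bijection_mulA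
  bijection_mul1g bijection_mulg1 bijection_mulVg bijection_mulgV.

End Bijections.

(** * The induced action that encodes the rolling map *)

Section RollingAction.
Local Open Scope group_scope.
Variables (G : groupType) (m : nat).
Implicit Types (i : nat) (x : G).

Definition diag_bij (y : nat -> G) : bijection (nat * G).
Proof.
apply: (@Bijection _ (fun p => (p.1, y p.1 * p.2))
  (fun p => (p.1, (y p.1)^-1 * p.2))) => -[i x] /=.
- by rewrite mulKg.
- by rewrite mulVKg.
Defined.

Lemma diag_bijM y z : diag_bij y * diag_bij z = diag_bij (fun i => y i * z i).
Proof. by apply: bijectionP => -[i x] /=; rewrite mulgA. Qed.

Lemma diag_bijV y : (diag_bij y)^-1 = diag_bij (fun i => (y i)^-1).
Proof. by apply: bijectionP. Qed.

Lemma eval_word_diag (J : Type) (y : J -> nat -> G) (w : seq (J * bool)) :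
  eval_word (fun j => diag_bij (y j)) w =
  diag_bij (fun i => eval_word (fun j => y j i) w).
Proof.
elim: w => [|[j b] w IH] /=.
  by apply: bijectionP => -[i x] /=; rewrite mul1g.
by rewrite IH; case: b; rewrite /eval_letter //= ?diag_bijV diag_bijM.
Qed.

Lemma eval_word_conj (J : Type) (c : J -> G) (w : seq (J * bool)) y :
  eval_word (fun j => y * c j * y^-1) w = y * eval_word c w * y^-1.
Proof.
elim: w => [|[j b] w IH] /=; first by rewrite mulg1 mulgV.
rewrite IH; case: b; rewrite /eval_letter /=; first by rewrite !mulgA mulgVK.
by rewrite !invgM !invgK !mulgA mulgVK.
Qed.

(** The sheets 0 to [m] rotate downwards, and only the wrap-around from 0 to [m] multiplies by [a],
    the image of [A^(m+1)]. Sheets above [m] are fixed. *)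
Definition shift_fun (a : G) (p : nat * G) : nat * G :=
  match p.1 with
  | 0 => (m, a * p.2)
  | i.+1 => if i < m then (i, p.2) else p
  end.

Definition shift_inv (a : G) (p : nat * G) : nat * G :=
  if p.1 < m then (p.1.+1, p.2) else
  if p.1 == m then (0, a^-1 * p.2) else p.

Definition shift_bij (a : G) : bijection (nat * G).
Proof.
apply: (@Bijection _ (shift_fun a) (shift_inv a)).
- move=> [[|i] x]; rewrite /shift_fun /shift_inv /=.
    by rewrite ltnn eqxx mulKg.
  case: (ltnP i m) => im /=; first by rewrite im.
  by rewrite ifF ?ifF //; lia.
- move=> [i x]; rewrite /shift_fun /shift_inv /=.
  case: ltngtP => im /=; first by rewrite im.
    by case: i im => // i im; rewrite ifF //; lia.
  by rewrite im mulVKg.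
Defined.

Variables (A B : G) (J : choiceType) (c : J -> G) (w : word J).

(* The intended isomorphism phi, with n = m + 1, sends A^i B A^-i to [roll_B i]
   and A^i (c j) A^-i to [roll_c j i]; with [shift_bij A] this is the action of
   [G] induced, along the transversal A^-i of the kernel, from the action of
   the kernel on [G] by left translations through phi. The indices i > m are
   junk, and [roll_c] is trivial there to satisfy the defining relation. *)
Definition roll_B i : G := B ^+ (m.+1 - i) * A * B ^+ i * A^-1.
Definition roll_c (j : J) i : G :=
  if i <= m then B ^+ (m - i) * c j * (B ^+ (m - i))^-1 else 1.

Lemma eval_roll_c i : eval_word (fun j => roll_c j i) w =
  if i <= m then B ^+ (m - i) * eval_word c w * (B ^+ (m - i))^-1 else 1.
Proof.
rewrite /roll_c; case: leqP => _; first exact: eval_word_conj.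
elim: {+}w => [//|[j b] u /= ->]; rewrite /eval_letter /=.
by case: b; rewrite ?invg1 mulg1.
Qed.

Definition rolling (F : {multiplicative G -> bijection (nat * G)}) : Prop :=
  [/\ F A =1 shift_fun A, F B =1 diag_bij roll_B &
      forall j, F (c j) =1 diag_bij (roll_c j)].

(** Read as [A B = k B A], the handle relation asks that [roll_B (i+1)] equal [k_i * roll_B i],
    where [k_i] is [k] conjugated by [B^(m-i)]; at sheet 0 the wrap-around closes the cycle, because
    [A B^(m+1) = k B A B^m]. *)
Lemma rolling_exists : handle A B c w -> exists F, rolling F.
Proof.
move=> [rel lift _].
have [|F [FA FB Fc]] := lift (bijection (nat * G)) (shift_bij A)
    (diag_bij roll_B) (fun j => diag_bij (roll_c j)); last first.
  by exists F; split=> [p|p|j p]; rewrite ?FA ?FB ?Fc.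
rewrite eval_word_diag /commutator; apply/divg1_eq.
set k := diag_bij (fun i => eval_word _ w).
suff -> : shift_bij A * diag_bij roll_B =
    k * (diag_bij roll_B * shift_bij A).
  by rewrite !mulgA !mulgK mulgV.
apply: bijectionP => -[i x]; rewrite /= /shift_fun /roll_B /=.
case: i => [|i] /=.
  rewrite eval_roll_c leqnn subnn -rel subSnn expg0 expg1 mul1g invg1 !mulg1.
  by rewrite /commutator subn0 expgS !mulgA !mulgVK mulgK.
rewrite subSS; case: ltnP => im /=.
  rewrite eval_roll_c ltnW // -rel /commutator subSn 1?ltnW //.
  by rewrite (expgSr B (m - i)) expgS !mulgA !mulgVK.
by rewrite eval_roll_c ifF ?mul1g // ; lia.
Qed.

End RollingAction.

(** * The rolling isomorphism between finite-index subgroups *)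

Section Rolling.
Local Open Scope group_scope.
Local Open Scope classical_set_scope.

Lemma bij_morphM (G : groupType) (X : Type)
    (F : {multiplicative G -> bijection X}) g h x : F (g * h) x = F g (F h x).
Proof. by rewrite gmulfM. Qed.

Lemma bij_morph1 (G : groupType) (X : Type)
    (F : {multiplicative G -> bijection X}) x : F 1 x = x.
Proof. by rewrite mult1. Qed.

Lemma bij_morphV (G : groupType) (X : Type)
    (F : {multiplicative G -> bijection X}) g x y : F g x = y -> F g^-1 y = x.
Proof. by move=> <-; rewrite multV /= bij_funK. Qed.

Section Shift.
Variables (G : groupType) (m : nat) (A B : G) (J : choiceType) (c : J -> G).
Variable F : {multiplicative G -> bijection (nat * G)}.
Hypothesis rF : rolling m A B c F.

Lemma rolling_A0 x : F A (0, x) = (m, A * x).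
Proof. by case: rF => FA _ _; rewrite FA. Qed.

Lemma rolling_AS i x : i < m -> F A (i.+1, x) = (i, x).
Proof. by case: rF => FA _ _ im; rewrite FA /shift_fun /= im. Qed.

Lemma rolling_B i x :
  F B (i, x) = (i, B ^+ (m.+1 - i) * A * B ^+ i * A^-1 * x).
Proof. by case: rF => _ FB _; rewrite FB. Qed.

Lemma rolling_c j i x : i <= m ->
  F (c j) (i, x) = (i, B ^+ (m - i) * c j * (B ^+ (m - i))^-1 * x).
Proof. by case: rF => _ _ Fc im; rewrite Fc /= /roll_c im. Qed.

Lemma rolling_AXdown i x : i <= m -> F (A ^+ i) (i, x) = (0, x).
Proof.
elim: i => [|i IH] im; first by rewrite bij_morph1.
by rewrite expgSr bij_morphM rolling_AS // IH // ltnW.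
Qed.

Lemma rolling_AX i x : 0 < i <= m.+1 -> F (A ^+ i) (0, x) = (m.+1 - i, A * x).
Proof.
case: i => // i; rewrite /= ltnS.
elim: i => [|i IH] im; first by rewrite expg1 rolling_A0 subn1.
rewrite expgS bij_morphM IH 1?ltnW // !subSS subnS.
rewrite -{1}[m - i]prednK ?subn_gt0 //.
by rewrite rolling_AS //; lia.
Qed.

End Shift.

Section RollingInverse.
Variables (G : groupType) (m : nat) (A B : G) (J : choiceType) (c : J -> G).
Variable w : word J.
Hypothesis hG : handle A B c w.
Variables F F' : {multiplicative G -> bijection (nat * G)}.
Hypotheses (rF : rolling m A B c F) (rF' : rolling m B A c F').

(* A^j g A^-i lies in the kernel, phi maps it to [z], and the isomorphism phi'
   obtained by exchanging A and B maps [z] back to it. Checking this relation on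
   generators shows that phi and phi' are inverse to each other. *)
Definition rolls g i j : Prop := exists z : G,
  (forall x, F g (i, x) = (j, z * x)) /\
  (forall x, F' z (0, x) = (0, A ^+ j * g * (A ^+ i)^-1 * x)).

Lemma rollsM g h i j k : rolls h i j -> rolls g j k -> rolls (g * h) i k.
Proof.
move=> [y [Fh F'y]] [z [Fg F'z]]; exists (z * y); split=> x.
  by rewrite bij_morphM Fh Fg mulgA.
by rewrite bij_morphM F'y F'z !mulgA mulgVK.
Qed.

Lemma rollsV g i j : rolls g i j -> rolls g^-1 j i.
Proof.
move=> [z [Fg F'z]]; exists z^-1; split=> x.
  by apply: bij_morphV; rewrite Fg mulVKg.
by apply: bij_morphV; rewrite F'z !mulgA mulgVK mulgK mulgV mul1g.
Qed.

Lemma rolls_A0 : rolls A 0 m.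
Proof.
exists A; split=> x; first by rewrite (rolling_A0 rF).
by rewrite (rolling_B rF') subn0 !expg0 invg1 !mulg1 mulgK expgSr.
Qed.

Lemma rolls_AS i : i < m -> rolls A i.+1 i.
Proof.
move=> im; exists 1; split=> x; first by rewrite (rolling_AS rF) // mul1g.
by rewrite bij_morph1 -expgSr mulgV mul1g.
Qed.

Lemma rolls_B i : i <= m -> rolls B i i.
Proof.
move=> im; exists (B ^+ (m.+1 - i) * A * B ^+ i * A^-1); split=> x.
  exact: (rolling_B rF).
(* At sheet 0 the image of [B] is [B^(m+1)], one full turn under [F']. On the other sheets the turn
   is interrupted by a factor [A]. *)
case: i im => [|i] im.
  rewrite subn0 mulg1 mulgK (rolling_AX rF') ?leqnn // subnn.
  by rewrite expg0 invg1 mulg1 mul1g.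
(* [F' A] multiplies sheet 0 by [A^(m+1)], so in this form [F' A^-1] just strips a factor. *)
have -> : x = A ^+ m.+1 * ((A ^+ m.+1)^-1 * x) by rewrite mulVKg.
move: (_ * x) => {}x.
have F'A y : F' A^-1 (0, A ^+ m.+1 * y) = (0, y).
  by apply: bij_morphV; rewrite (rolling_B rF') subn0 expg0 mulg1 mulgK.
rewrite !bij_morphM F'A (rolling_AX rF') ?(leqW im) // (rolling_B rF').
have im' : m.+1 - i.+1 <= m by rewrite subSS leq_subr.
rewrite (rolling_AXdown rF') // subKn 1?leqW //.
rewrite !mulgA mulgVK; congr (_, _ * _).
rewrite -!mulgA; congr (_ * (_ * _)).
by apply: (@mulgI _ (A ^+ i.+1)); rewrite mulVKg -expgnDr subnKC // leqW.
Qed.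

Lemma rolls_c j i : i <= m -> rolls (c j) i i.
Proof.
move=> im; exists (B ^+ (m - i) * c j * (B ^+ (m - i))^-1); split=> x.
  exact: (rolling_c rF).
have F'B y : F' (B ^+ (m - i))^-1 (0, y) = (m - i, y).
  by apply: bij_morphV; rewrite (rolling_AXdown rF') // leq_subr.
rewrite !bij_morphM F'B (rolling_c rF') ?leq_subr // subKn //.
by rewrite (rolling_AXdown rF') // leq_subr.
Qed.

(** Totality is asked in both directions so that the set is closed under inverses and [handle_ind]
    applies. *)
Definition rolls_set : set G := [set g |
  (forall i, i <= m -> exists2 j, j <= m & rolls g i j) /\
  (forall j, j <= m -> exists2 i, i <= m & rolls g i j)].

Lemma rolls_set1 : rolls_set 1.
Proof.
have r1 i : rolls 1 i i.
  exists 1; split=> x; first by rewrite bij_morph1 mul1g.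
  by rewrite bij_morph1 mulg1 mulgV mul1g.
by split=> i im; exists i.
Qed.

Lemma rolls_setF g h : rolls_set g -> rolls_set h -> rolls_set (g / h).
Proof.
move=> [g1 g2] [h1 h2]; split=> [i /h2[j jm hj]|k /g2[j jm gj]].
  have [k km gk] := g1 j jm; exists k => //; exact: rollsM (rollsV hj) gk.
have [i im hi] := h1 j jm; exists i => //; exact: rollsM (rollsV hi) gj.
Qed.

Lemma rolls_exists g i : i <= m -> exists2 j, j <= m & rolls g i j.
Proof.
suff : rolls_set g by case=> r _; exact: r.
apply: (handle_ind hG (S := mk_subgroup rolls_set1 rolls_setF)) => [||j] /=.
- split=> [[|k] im|j jm]; first by exists m => //; exact: rolls_A0.
    by exists k; [exact: ltnW|exact: rolls_AS].
  move: jm; rewrite leq_eqVlt => /orP[/eqP ->|jm].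
    by exists 0 => //; exact: rolls_A0.
  by exists j.+1 => //; exact: rolls_AS.
- by split=> k km; exists k => //; exact: rolls_B.
- by split=> k km; exists k => //; exact: rolls_c.
Qed.

(** Elements act on sheet 0 by left multiplications, which commute with right translations; hence
    the value at [(0, 1)] determines the action on the sheet. *)
Lemma rolling_equivariant g x y :
  F g (0, x * y) = ((F g (0, x)).1, (F g (0, x)).2 * y).
Proof.
by have [//|j _ [z [Fg _]]] := @rolls_exists g 0; rewrite !Fg mulgA.
Qed.

Lemma rolling_fst g : (F g (0, 1)).1 <= m.
Proof. by have [//|j jm [z [Fg _]]] := @rolls_exists g 0; rewrite Fg. Qed.

(** When [g] fixes sheet 0, the index [j] in [rolls] is 0, so no power of [A] intervenes and phi'
    takes phi of [g] back to [g]. *)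
Lemma rolling_cancel g x : F g (0, 1) = (0, x) -> F' x (0, 1) = (0, g).
Proof.
have [//|j _ [z [Fg F'z]]] := @rolls_exists g 0.
rewrite Fg mulg1 => -[j0 <-]; rewrite F'z j0.
by rewrite expg0 invg1 mul1g !mulg1.
Qed.

Lemma rolling_preim g x y : F g (0, 1) = (0, x) -> F g (0, y) = (0, x * y).
Proof. by move=> e; rewrite -[y in LHS]mul1g rolling_equivariant e. Qed.

(** As [A] rotates the sheets up to [m] and the other generators fix them, this stabilizer of sheet
    0 is the kernel of the map to Z/(m+1). *)
Definition rolling_set : set G := [set g | (F g (0, 1)).1 = 0].

Lemma rolling_setP g : rolling_set g -> F g (0, 1) = (0, (F g (0, 1)).2).
Proof. by rewrite /rolling_set /=; case: (F g _) => i x /= ->. Qed.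

Lemma rolling_mapM g h : rolling_set g -> rolling_set h ->
  F (g * h) (0, 1) = (0, (F g (0, 1)).2 * (F h (0, 1)).2).
Proof.
move=> /rolling_setP/rolling_preim Fg /rolling_setP Fh.
by rewrite bij_morphM Fh Fg.
Qed.

Fact rolling_set1 : rolling_set 1.
Proof. by rewrite /rolling_set /= bij_morph1. Qed.

Fact rolling_setF g h : rolling_set g -> rolling_set h -> rolling_set (g / h).
Proof.
move=> /rolling_setP/rolling_preim Fg /rolling_setP/rolling_preim Fh.
rewrite /rolling_set /=; rewrite bij_morphM.
have -> : F h^-1 (0, 1) = (0, ((F h (0, 1)).2)^-1).
  by apply: bij_morphV; rewrite Fh mulgV.
by rewrite Fg.
Qed.

Definition rolling_subgroup : subgroup G :=
  mk_subgroup rolling_set1 rolling_setF.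

Lemma rolling_index : finite_index rolling_subgroup.
Proof.
apply: (@finite_indexP _ _ _ (fun g => (F g (0, 1)).1)).
  apply: sub_finite_set (finite_II m.+1) => _ [g _ <-] /=.
  exact: rolling_fst.
move=> g h e; rewrite /= /rolling_set /= bij_morphM.
(* Two elements taking sheet 0 to the same sheet differ there by a right translation, so [g^-1 h]
   fixes sheet 0. *)
have -> : F h (0, 1) = F g (0, ((F g (0, 1)).2)^-1 * (F h (0, 1)).2).
  rewrite -[X in F g (_, X)]mul1g rolling_equivariant mulVKg e.
  by case: (F h _).
by rewrite -bij_morphM mulVg bij_morph1.
Qed.

End RollingInverse.

(** Values of [fi_map] outside [fi_dom] are junk, so every evaluation carries its membership
    proof. *)
Definition maps_to (G : groupType) (phi : fi_iso G) (x y : G) : Prop :=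
  sg_set (fi_dom phi) x /\ phi x = y.

(** The codomain is the stabilizer of sheet 0 for the action with [A] and [B] exchanged;
    [rolling_cancel], applied to both orders of the two actions, gives a two-sided inverse. *)
Lemma rolling_iso (G : groupType) (A B : G) (J : choiceType) (c : J -> G)
    (w : word J) (m : nat) : handle A B c w ->
  exists phi : fi_iso G,
    [/\ maps_to phi (A ^+ m.+1) A, maps_to phi B (B ^+ m.+1) &
        forall i, i <= m -> maps_to phi
          (A ^+ i * commutator A B * (A ^+ i)^-1)
          (B ^+ (m - i) * commutator A B * (B ^+ (m - i))^-1)].
Proof.
move=> hG; have hG' := handle_swap hG.
have [F rF] := rolling_exists m hG; have [F' rF'] := rolling_exists m hG'.
pose phi (g : G) := (F g (0, 1)).2.
have phiM x y : sg_set (rolling_subgroup hG rF rF') x ->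
    sg_set (rolling_subgroup hG rF rF') y -> phi (x * y) = phi x * phi y.
  by move=> Hx Hy; rewrite /phi (rolling_mapM hG rF rF').
have phi_bij : set_bij (sg_set (rolling_subgroup hG rF rF'))
    (sg_set (rolling_subgroup hG' rF' rF)) phi.
  split=> [x /rolling_setP/(rolling_cancel hG rF rF')|x y|y].
  - by rewrite /= /rolling_set /= => ->.
  - move=> /set_mem/rolling_setP/(rolling_cancel hG rF rF') ex.
    move=> /set_mem/rolling_setP/(rolling_cancel hG rF rF') ey.
    by rewrite /phi => e; move: ex; rewrite e ey => -[].
  - move=> /rolling_setP/(rolling_cancel hG' rF' rF) ey.
    by exists (F' y (0, 1)).2; rewrite /= /rolling_set /phi /= ey.
exists (FiIso (rolling_index hG rF rF') (rolling_index hG' rF' rF) phiM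
  phi_bij).
rewrite /maps_to /= /rolling_set /phi /=.
have FB x : F B (0, x) = (0, B ^+ m.+1 * x).
  by rewrite (rolling_B rF) subn0 mulg1 mulgK.
split=> [||i im].
- by rewrite (rolling_AX rF) ?leqnn // subnn mulg1.
- by rewrite FB mulg1.
- have Fk x : F (commutator A B) (i, x) =
      (i, B ^+ (m - i) * commutator A B * (B ^+ (m - i))^-1 * x).
    rewrite (handle_rel hG) eval_word_morph.
    have -> : F \o c = fun j => diag_bij (roll_c m B c j).
      by have [_ _ Fc] := rF; apply/funext => j; exact/bijectionP/Fc.
    by rewrite eval_word_diag /= eval_roll_c im.
  rewrite 2!bij_morphM.
  have -> : F (A ^+ i)^-1 (0, 1) = (i, 1).
    by apply: bij_morphV; rewrite (rolling_AXdown rF).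
  by rewrite Fk (rolling_AXdown rF) // mulg1.
Qed.

End Rolling.

(** * Evaluating and comparing elements of the commensurator *)

Section CommensuratorFacts.
Local Open Scope group_scope.
Local Open Scope classical_set_scope.
Variable G : groupType.
Implicit Types (phi psi : fi_iso G) (x y z g h : G).

(** Pigeonhole: two powers of [x] share one of the finitely many left cosets. *)
Lemma finite_index_power (K : subgroup G) x :
  finite_index K -> exists2 r, 0 < r & sg_set K (x ^+ r).
Proof.
move=> fK; apply: contrapT => no.
have inj : injective (fun i => left_coset K (x ^+ i)).
  suff lt i j : i < j -> left_coset K (x ^+ i) <> left_coset K (x ^+ j).
    by move=> i j e; case: (ltngtP i j) => // /lt; rewrite e.
  move=> ij /left_cosetP Kx; apply: no.
  exists (j - i); first by rewrite subn_gt0.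
  suff -> : x ^+ (j - i) = (x ^+ i)^-1 * x ^+ j by [].
  by apply: (@mulgI _ (x ^+ i)); rewrite mulVKg -expgnDr subnKC // ltnW.
apply: infinite_nat.
apply: sub_finite_set (finite_preimage (in2W inj) fK) => i _.
by exists (x ^+ i).
Qed.

Lemma maps_to1 phi : maps_to phi 1 1.
Proof. by split; [exact: sg1|exact: fi_map1]. Qed.

Lemma maps_toM phi x x' y y' :
  maps_to phi x x' -> maps_to phi y y' -> maps_to phi (x * y) (x' * y').
Proof. by move=> [Dx <-] [Dy <-]; split; [exact: sgM|exact: fi_mapM]. Qed.

Lemma maps_toV phi x x' : maps_to phi x x' -> maps_to phi x^-1 x'^-1.
Proof. by move=> [Dx <-]; split; [exact: sgV|exact: fi_mapV]. Qed.

Lemma maps_toX phi x y n : maps_to phi x y -> maps_to phi (x ^+ n) (y ^+ n).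
Proof.
move=> xy; elim: n => [|n IH]; first exact: maps_to1.
by rewrite !expgS; exact: maps_toM.
Qed.

Lemma maps_to_comp phi psi x y z :
  maps_to psi x y -> maps_to phi y z -> maps_to (fi_comp phi psi) x z.
Proof. by move=> [Dx <-] [Dy <-]. Qed.

Lemma maps_to_inv phi x y : maps_to phi x y -> maps_to (fi_inv phi) y x.
Proof. by move=> [Dx <-]; split; [exact: fi_fun|exact: fi_inv_mapK]. Qed.

Fact inner_mapM g x y : sg_set (full_subgroup G) x ->
  sg_set (full_subgroup G) y ->
  g * (x * y) * g^-1 = (g * x * g^-1) * (g * y * g^-1).
Proof. by move=> _ _; rewrite !mulgA mulgVK. Qed.

Fact inner_bij g : set_bij (sg_set (full_subgroup G))
  (sg_set (full_subgroup G)) (fun x => g * x * g^-1).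
Proof.
split=> // [x y _ _ /mulIg/mulgI//|x _].
by exists (g^-1 * x * g); rewrite // !mulgA mulgV mul1g mulgK.
Qed.

Definition inner g : fi_iso G :=
  FiIso (@finite_index_full G) (@finite_index_full G) (inner_mapM g)
    (inner_bij g).

Lemma maps_to_inner g x : maps_to (inner g) x (g * x * g^-1).
Proof. by []. Qed.

Definition comm_class phi : Comm G := pg_class (phi : comm_pregroup G).

Lemma comm_classM phi psi :
  comm_class (fi_comp phi psi) = comm_class phi * comm_class psi.
Proof. exact: (@pg_classM (comm_pregroup G)). Qed.

Lemma comm_classV phi : comm_class (fi_inv phi) = (comm_class phi)^-1.
Proof. exact: (@pg_classV (comm_pregroup G)). Qed.

Lemma comm_class_innerM g h :
  comm_class (inner (g * h)) = comm_class (inner g) * comm_class (inner h).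
Proof.
rewrite -comm_classM; apply/pg_classE/comm_sub => // x _ /=.
by rewrite invgM !mulgA.
Qed.

Lemma comm_class_innerX g n :
  comm_class (inner (g ^+ n)) = comm_class (inner g) ^+ n.
Proof.
elim: n => [|n IH]; last by rewrite !expgS comm_class_innerM IH.
apply/pg_classE/comm_sub => // x _ /=; by rewrite mul1g invg1 mulg1.
Qed.

Lemma comm_class_conj phi g h : maps_to phi g h ->
  comm_class phi * comm_class (inner g) * (comm_class phi)^-1 =
  comm_class (inner h).
Proof.
move=> [Dg <-]; apply: (@mulIg _ (comm_class phi)); rewrite mulgVK.
rewrite -!comm_classM; apply/pg_classE.
exists (fi_dom phi); split=> [|x Dx|x Dx|x Dx] /=.
- exact: fi_dom_index.
- by split=> //=; apply: sgM; [exact: sgM|exact: sgV].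
- by split.
- by rewrite fi_mapM ?fi_mapM ?fi_mapV //; [exact: sgM|exact: sgV].
Qed.

(** Equal classes agree only on a finite-index subgroup, which contains some positive power of [x].
    To separate classes, one therefore exhibits values without a common positive power. *)
Lemma comm_class_eq phi psi x y z : comm_class phi = comm_class psi ->
  maps_to phi x y -> maps_to psi x z -> exists2 r, 0 < r & y ^+ r = z ^+ r.
Proof.
move=> /pg_classE[K [fK _ _ e]] xy xz.
have [r r0 Kr] := finite_index_power x fK; exists r => //.
by have [_ <-] := maps_toX r xy; have [_ <-] := maps_toX r xz; exact: e.
Qed.

End CommensuratorFacts.

(** * Injectivity for [BS(1,n)] and failure of residual finiteness for [BS(2,3)] *)

Section BaumslagSolitar.
Local Open Scope group_scope.
Local Open Scope classical_set_scope.

Lemma multX (K L : groupType) (f : {multiplicative K -> L}) x k :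
  f (x ^+ k) = f x ^+ k.
Proof. by elim: k => [|k IH]; rewrite ?mult1 // !expgS gmulfM IH. Qed.

Lemma multXz (K L : groupType) (f : {multiplicative K -> L}) x z :
  f (expgz x z) = expgz (f x) z.
Proof. by case: z => k; rewrite /expgz ?multV multX. Qed.

Lemma BS_presentation (m n : int) : exists a b : BS m n,
  [/\ a * expgz b m * a^-1 = expgz b n,
      forall (M : groupType) (x y : M), x * expgz y m * x^-1 = expgz y n ->
        exists f : {multiplicative (BS m n) -> M}, f a = x /\ f b = y &
      forall S : subgroup (BS m n), sg_set S a -> sg_set S b ->
        forall u, sg_set S u].
Proof.
rewrite /BS; set a := free_gen _; set b := free_gen _.
set S := (X in presented_group X).
exists (presented_proj S a), (presented_proj S b); split=> [|M x y e|T Ta Tb].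
- apply: divg1_eq; rewrite -!multXz -!multV -!gmulfM.
  exact: presented_proj_rel.
- have [f fE] := free_group_lift (fun i : 'I_2 => if val i is 0 then x else y).
  have [|F FE] := @presented_group_lift _ S _ f.
    by move=> _ ->; rewrite !gmulfM !multV !multXz !fE /= e mulgV.
  by exists F; rewrite !FE !fE.
- apply: presented_group_ind => -[[|[|//]] lt2].
    by rewrite (_ : Ordinal _ = @Ordinal 2 0 isT)//; exact: val_inj.
  by rewrite (_ : Ordinal _ = @Ordinal 2 1 isT)//; exact: val_inj.
Qed.

Lemma conj_powers (G : groupType) (x y : G) p q k :
  x * y ^+ p * x^-1 = y ^+ q -> x * y ^+ (p * k) * x^-1 = y ^+ (q * k).
Proof.
move=> e; rewrite !expgnA -e; elim: k => [|k IH].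
  by rewrite !expg0 mulg1 mulgV.
by rewrite !expgS -IH !mulgA mulgVK.
Qed.

Lemma mul_iterated_conj (G : groupType) (x y : G) n j :
  x * y * x^-1 = y ^+ n -> x ^+ j * y = y ^+ (n ^ j) * x ^+ j.
Proof.
move=> e; elim: j => [|j IH]; first by rewrite mulg1 mul1g.
rewrite expgS -mulgA IH mulgA -[x * _](mulgVK x).
have := @conj_powers G x y 1 n (n ^ j) e; rewrite mul1n => ->.
by rewrite -!mulgA expnS.
Qed.

Section SolvableNormalForm.
Variables (n : nat) (a b : BS 1%Z n).
Hypothesis rel : a * b * a^-1 = b ^+ n.
Hypothesis ind : forall S : subgroup (BS 1%Z n), sg_set S a -> sg_set S b ->
  forall u, sg_set S u.

(** Positive powers of [a] move right past [b] by raising it to a power of [n], and negative ones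
    collect on the left. The integer exponent of [b] is written [p - q] with natural numbers. *)
Lemma BS1_normal_form u : exists i p q j,
  u = (a ^+ i)^-1 * (b ^+ p * (b ^+ q)^-1) * a ^+ j.
Proof.
pose N := [set u | exists i p q j,
  u = (a ^+ i)^-1 * (b ^+ p * (b ^+ q)^-1) * a ^+ j].
have Na u' : N u' -> N (u' * a).
  by move=> [i [p [q [j ->]]]]; exists i, p, q, j.+1; rewrite -mulgA -expgSr.
have Nb u' : N u' -> N (u' * b).
  move=> [i [p [q [j ->]]]]; exists i, (n ^ j + p), q, j.
  rewrite -mulgA (mul_iterated_conj _ rel) !mulgA; congr (_ * _).
  rewrite -!mulgA; congr (_ * _); rewrite mulgA.
  have /commuteV : commute (b ^+ (n ^ j)) (b ^+ q).
    exact: commuteX2 (commute_refl b).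
  rewrite /commute => e.
  by rewrite -mulgA -e mulgA -expgnDr addnC.
have Na' u' : N u' -> N (u' * a^-1).
  move=> [i [p [q [[|j] ->]]]]; last first.
    by exists i, p, q, j; rewrite -mulgA expgSr mulgK.
  (* With no [a] left to cancel, [a^-1] is pulled to the left end, where conjugation by [a]
     multiplies both exponents by [n]. *)
  exists i.+1, (n * p)%N, (n * q)%N, 0; rewrite !mulg1 expgS invgM.
  have e k : b ^+ (n * k) = a * b ^+ k * a^-1.
    by have := @conj_powers _ a b 1 n k rel; rewrite mul1n => <-.
  by rewrite !e !invgM invgK !mulgA !mulgVK.
have Nb' u' : N u' -> N (u' * b^-1).
  move=> [i [p [q [j ->]]]]; exists i, p, (q + n ^ j), j.
  rewrite -mulgA; have -> : a ^+ j * b^-1 = (b ^+ (n ^ j))^-1 * a ^+ j.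
    apply: (@mulIg _ b).
    by rewrite mulgVK -mulgA (mul_iterated_conj _ rel) mulKg.
  by rewrite !mulgA addnC expgnDr invgM !mulgA.
(* [N] is not visibly a subgroup, but the elements preserving it by right multiplication, together
   with their inverses, form one. *)
pose S := [set g | forall u', N u' -> N (u' * g) /\ N (u' * g^-1)].
have S1 : S 1 by move=> u' Nu; rewrite invg1 mulg1.
have SF x y : S x -> S y -> S (x / y).
  move=> Sx Sy u' Nu; rewrite invgM invgK !mulgA; split.
    by apply: (Sy _ _).2; apply: (Sx _ _).1.
  by apply: (Sx _ _).2; apply: (Sy _ _).1.
have Su : sg_set (mk_subgroup S1 SF) u.
  apply: ind => u' Nu; split; [exact: Na|exact: Na'|exact: Nb|exact: Nb'].
have N1 : N 1 by exists 0, 0, 0, 0; rewrite !invg1 !mulg1.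
by have [] := Su 1 N1; rewrite mul1g.
Qed.

(** A kernel element in normal form equates a power of [f b] with [f a] to the power [i - j]. This
    commutes with [f b], whereas a nonzero power of [f a] changes the exponent of [f b]; so [i = j],
    and infinite order gives [p = q]. *)
Lemma BS1_injective (M : groupType) (f : {multiplicative (BS 1%Z n) -> M}) :
  1 < n -> (forall s, f b ^+ s = 1 -> s = 0) -> injective f.
Proof.
move=> n1 inf.
have frel : f a * f b * (f a)^-1 = f b ^+ n.
  by rewrite -multV -multX -!gmulfM rel.
have powI p q : f b ^+ p = f b ^+ q -> p = q.
  suff lt i j : i < j -> f b ^+ i <> f b ^+ j.
    by move=> e; case: (ltngtP p q) => // /lt; rewrite e.
  move=> ij e; have : j - i = 0.
    apply: inf; apply: (@mulgI _ (f b ^+ i)).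
    by rewrite -expgnDr subnKC ?mulg1 // ltnW.
  by lia.
have comm0 d : commute (f a ^+ d) (f b) -> d = 0.
  rewrite /commute (mul_iterated_conj _ frel) => /mulIg e.
  have : (n ^ d = 1)%N by apply: powI; rewrite expg1.
  by case: d {e} => // d /eqP; rewrite expnS muln_eq1 => /andP[/eqP ? _]; lia.
suff ker u : f u = 1 -> u = 1.
  by move=> u v e; apply/divg1_eq/ker; rewrite gmulfM multV e mulgV.
have [i [p [q [j ->]]]] := BS1_normal_form u.
rewrite !gmulfM !multV !multX => e.
have eij : f b ^+ p * (f b ^+ q)^-1 = f a ^+ i * (f a ^+ j)^-1.
  apply: (@mulgI _ (f a ^+ i)^-1); apply: (@mulIg _ (f a ^+ j)).
  by rewrite e mulKg mulVg.
have cb : commute (f a ^+ i * (f a ^+ j)^-1) (f b).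
  rewrite -eij; apply/commute_sym/commuteM; first exact: commuteX.
  exact/commuteV/commuteX.
have e0 : i = j.
  have sub x d k : x ^+ (k + d) * (x ^+ k)^-1 = x ^+ d :> M.
    by rewrite addnC expgnDr mulgK.
  case: (leqP i j) => [|/ltnW] /subnKC ij; rewrite -ij in cb *.
    suff -> : j - i = 0 by rewrite addn0.
    apply: comm0; move: cb => /commute_sym/commuteV/commute_sym.
    by rewrite invgM invgK sub.
  suff -> : i - j = 0 by rewrite addn0.
  by apply: comm0; move: cb; rewrite sub.
have pq : p = q.
  by apply: powI; move: eij; rewrite e0 mulgV => /divg1_eq.
by rewrite e0 pq mulgV mulg1 mulVg.
Qed.

End SolvableNormalForm.

Lemma image_subgroup_iso (G H : groupType) (f : {multiplicative G -> H}) :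
  injective f -> isomorphic (subgroup_type (image_subgroup f)) G.
Proof.
move=> injf.
have fP (y : subgroup_type (image_subgroup f)) : exists x, f x = val y.
  by have /set_mem[x _ e] := valP y; exists x.
have [g gE] := choice fP.
have gM : {morph g : x y / x * y}.
  by move=> x y; apply: injf; rewrite gmulfM !gE.
pose F : {multiplicative (subgroup_type (image_subgroup f)) -> G} :=
  HB.pack g (isMultiplicative.Build _ _ g gM).
exists F; have fI x : f x \in sg_set (image_subgroup f).
  by apply: mem_set; exists x.
exists (fun x => Sub (f x) (fI x)) => [y|x] /=.
  by apply: val_inj; rewrite SubK gE.
by apply: injf; rewrite gE SubK.
Qed.

Lemma BS1_in_comm (M : groupType) (n : nat) (x y : M) : 1 < n ->
  x * y * x^-1 = y ^+ n -> (forall s, y ^+ s = 1 -> s = 0) ->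
  exists H : subgroup M, isomorphic (subgroup_type H) (BS 1%Z n).
Proof.
move=> n1 e inf; have [a [b [rel lift ind]]] := BS_presentation 1 n.
have [f [fa fb]] := lift M x y e.
exists (image_subgroup f); apply: image_subgroup_iso.
by apply: (BS1_injective rel ind n1); rewrite fb.
Qed.

Lemma finite_quotient_commute (Q : finGroupType) (x y : Q) :
  x * y ^+ 2 * x^-1 = y ^+ 3 -> commute (x * y * x^-1) y.
Proof.
(* [y ^+ 2] and [y ^+ 3] are conjugate, so the order of [y] is prime to 6 and
   [y] is a power of [y ^+ 2]. *)
move=> e; have oddy : odd #[y].
  have : #[y ^+ 2] = #[y ^+ 3].
    by rewrite -e -(orderJ (y ^+ 2) x^-1) conjgE invgK mulgA.
  rewrite !orderXgcd => E.
  have g23 : gcdn #[y] 2 = gcdn #[y] 3.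
    have h2 := divnK (dvdn_gcdl #[y] 2); have h3 := divnK (dvdn_gcdl #[y] 3).
    apply/eqP; rewrite -(@eqn_pmul2l (#[y] %/ gcdn #[y] 2)); last first.
      rewrite divn_gt0 ?gcdn_gt0 ?order_gt0 // dvdn_leq ?order_gt0 //.
      exact: dvdn_gcdl.
    by rewrite h2 E h3.
  rewrite -coprimen2 /coprime -dvdn1 -[1%N]/(gcdn 2 3) dvdn_gcd.
  by rewrite {2}g23 !dvdn_gcdr.
(* As [2 * uphalf #[y]] is [#[y] + 1], this writes the conjugate of [y] itself as a power of [y]. *)
have := conj_powers (uphalf #[y]) e.
have -> : (2 * uphalf #[y] = #[y].+1)%N by rewrite uphalf_half oddy; lia.
rewrite expgS expg_order mulg1 => ->.
exact/commute_sym/commuteX.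
Qed.

Lemma BS23_not_rf (M : groupType) (x y : M) :
  x * y ^+ 2 * x^-1 = y ^+ 3 -> ~ commute (x * y * x^-1) y ->
  exists f : {multiplicative (BS 2%Z 3%Z) -> M},
     ~ residually_finite (subgroup_type (image_subgroup f)).
Proof.
move=> e nc; have [a [b [_ lift _]]] := BS_presentation 2 3.
have [f [fa fb]] := lift M x y e.
exists f => rf.
have xI : x \in sg_set (image_subgroup f) by apply: mem_set; exists a.
have yI : y \in sg_set (image_subgroup f) by apply: mem_set; exists b.
pose X : subgroup_type (image_subgroup f) := Sub x xI.
pose Y : subgroup_type (image_subgroup f) := Sub y yI.
have nc' : commutator (X * Y * X^-1) Y <> 1.
  move=> /(congr1 val); rewrite /commutator => /= c; apply: nc.
  by apply/divg1_eq; rewrite invgM mulgA.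
have [Q [h hw]] := rf _ nc'.
apply: hw; rewrite commutator_morph !gmulfM multV.
have : h X * h Y ^+ 2 * (h X)^-1 = h Y ^+ 3.
  by rewrite -!multX -multV -!gmulfM; congr (h _); apply: val_inj.
move=> /finite_quotient_commute; rewrite /commute /commutator => ->.
by rewrite mulgK mulgV.
Qed.

End BaumslagSolitar.

(** * Separating elements by affine maps of the rationals *)

Section AffineTest.
Import Order.TTheory GRing.Theory Num.Theory.
Local Open Scope ring_scope.

Definition double_bij : bijection rat.
Proof.
by apply: (@Bijection _ (fun v => 2 * v) (fun v => 2^-1 * v)) => v; field.
Defined.

Definition succ_bij : bijection rat.
Proof.
by apply: (@Bijection _ (fun v => v + 1) (fun v => v - 1)) => v; ring.
Defined.

Variables (G : groupType) (A B : G) (J : choiceType) (c : J -> G) (w : word J).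

Lemma affine_test : handle A B c w -> retractable w ->
  exists F : {multiplicative G -> bijection rat},
    (forall v, F A v = 2 * v) /\ (forall v, F B v = v + 1).
Proof.
move=> hG /(_ _ double_bij succ_bij)[d e].
have [F [FA FB _]] := handle_lift hG e.
by exists F; split=> v; rewrite ?FA ?FB.
Qed.

Variable F : {multiplicative G -> bijection rat}.
Hypotheses (FA : forall v, F A v = 2 * v) (FB : forall v, F B v = v + 1).

Lemma affine_AX r v : F (A ^+ r)%g v = 2 ^+ r * v.
Proof.
elim: r => [|r IH]; first by rewrite bij_morph1 expr0 mul1r.
by rewrite expgS bij_morphM IH FA exprS mulrA.
Qed.

Lemma affine_translationX g (t : rat) r v :
  (forall v, F g v = v + t) -> F (g ^+ r)%g v = v + r%:R * t.
Proof.
move=> Fg; elim: r => [|r IH]; first by rewrite bij_morph1; ring.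
by rewrite expgS bij_morphM IH Fg -addn1 natrD; ring.
Qed.

Lemma affine_fixX g r v : F g v = v -> F (g ^+ r)%g v = v.
Proof.
move=> Fg; elim: r => [|r IH]; first by rewrite bij_morph1.
by rewrite expgS bij_morphM IH Fg.
Qed.

(** The conjugate of [A] by [B^s] acts as the dilation centred at [s], while positive powers of [A]
    fix only 0. *)
Lemma affine_centralize s r : (0 < r)%N ->
  ((B ^+ s * A * (B ^+ s)^-1) ^+ r = A ^+ r)%g -> s = 0%N.
Proof.
move=> r0 /(congr1 (fun g => F g s%:R)); rewrite affine_AX affine_fixX.
  move=> e; apply/eqP; rewrite -(pnatr_eq0 rat).
  have /eqP : (2 ^+ r - 1) * s%:R = 0 :> rat by rewrite mulrBl mul1r -e subrr.
  rewrite mulf_eq0 subr_eq0 => /orP[/eqP E|//].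
  by have : 1 < (2 : rat) ^+ r by [rewrite exprn_egt1 // -lt0n]; rewrite E ltxx.
have FBV : F (B ^+ s)^-1%g s%:R = 0.
  by apply: bij_morphV; rewrite (affine_translationX _ _ FB); ring.
by rewrite !bij_morphM FBV FA (affine_translationX _ _ FB); ring.
Qed.

(** [k] acts as translation by 1, and conjugation by an affine map scales a translation by its
    ratio. The ratios are 8 for [B A B A^2] and 1 for [B]. *)
Lemma affine_conj_commutator r (k := commutator A B) : (0 < r)%N ->
  ((B * A * B * A ^+ 2 * k * (B * A * B * A ^+ 2)^-1) ^+ r <>
   (B * k * B^-1) ^+ r)%g.
Proof.
move=> r0 /(congr1 (fun g => F g 0)).
have FAV v : F A^-1%g v = 2^-1 * v by apply: bij_morphV; rewrite FA; field.
have FBV v : F B^-1%g v = v - 1 by apply: bij_morphV; rewrite FB; ring.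
have Fk v : F k v = v + 1.
  by rewrite /k /commutator !bij_morphM FBV FAV FB FA; field.
clearbody k.
rewrite (@affine_translationX _ 8) ?(@affine_translationX _ 1).
- have r1 : 0 < r%:R :> rat by rewrite ltr0n.
  by lra.
- by move=> v; rewrite !bij_morphM FBV Fk FB; ring.
- by move=> v; rewrite expgS expg1 !invgM !bij_morphM !(FAV, FBV, Fk, FA, FB);
    field.
Qed.

End AffineTest.

(** * The Baumslag-Solitar relations in the commensurator of a handle group *)

Section HandleCommensurator.
Local Open Scope group_scope.
Local Open Scope classical_set_scope.
Variables (G : groupType) (A B : G) (J : choiceType) (c : J -> G) (w : word J).
Hypotheses (hG : handle A B c w) (rw : retractable w).
Local Notation k := (commutator A B).
Local Notation conjk u := (u * k * u^-1).

(** The test element is [A]: a trivial power would give [A] and its conjugate by [B^s] a common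
    positive power. *)
Lemma comm_inner_infinite s : comm_class (inner B) ^+ s = 1 -> s = 0%N.
Proof.
have [F [FA FB]] := affine_test hG rw.
rewrite -comm_class_innerX => e.
have [|r r0 er] := @comm_class_eq G (inner (B ^+ s)) (fi_id G) A _ A e
  (maps_to_inner _ _); first by [].
exact: (affine_centralize FA FB r0 er).
Qed.

Lemma comm_BS1 n : 1 < n -> exists x y : Comm G,
  x * y * x^-1 = y ^+ n /\ forall s, y ^+ s = 1 -> s = 0.
Proof.
case: n => // m _; have [phi [_ phiB _]] := rolling_iso m hG.
exists (comm_class phi), (comm_class (inner B)); split; last first.
  exact: comm_inner_infinite.
by rewrite (comm_class_conj phiB) comm_class_innerX.
Qed.

Lemma maps_to_conj (phi : fi_iso G) x y u v : maps_to phi u v ->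
  maps_to phi x y -> maps_to phi (u * x * u^-1) (v * y * v^-1).
Proof. by move=> uv xy; apply/maps_toM/maps_toV/uv; exact: maps_toM. Qed.

(** This evaluates a conjugate of an inner automorphism without a formula for the inverse of [phi]:
    a candidate [z] is checked by applying [phi] to it. *)
Lemma maps_to_twist (phi : fi_iso G) x y u z : maps_to phi x y ->
  maps_to phi z (u * y * u^-1) ->
  maps_to (fi_comp (fi_inv phi) (fi_comp (inner u) phi)) x z.
Proof.
move=> xy zy; apply: maps_to_comp (maps_to_inv zy).
by apply: maps_to_comp xy _; exact: maps_to_inner.
Qed.

Lemma conjkM u v : u * conjk v * u^-1 = conjk (u * v).
Proof. by rewrite invgM !mulgA. Qed.

Lemma comm_BS23 : exists x y : Comm G,
  x * y ^+ 2 * x^-1 = y ^+ 3 /\ ~ commute (x * y * x^-1) y.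
Proof.
have [p2 [p2A p2B p2k]] := rolling_iso 1 hG.
have [p3 [p3A p3B p3k]] := rolling_iso 2 hG.
(* Since [p2] and [p3] conjugate [B] to [B^2] and [B^3], these are a square root and a cube root of
   [B]. *)
pose b p := fi_comp (fi_inv p) (fi_comp (inner B) p).
have k2 : maps_to p2 k (conjk B).
  by have := p2k 0 isT; rewrite expg0 expg1 mul1g invg1 mulg1.
have Ak2 : maps_to p2 (conjk A) k.
  by have := p2k 1%N isT; rewrite subnn expg0 expg1 mul1g invg1 mulg1.
have k3 : maps_to p3 k (conjk (B ^+ 2)).
  by have := p3k 0 isT; rewrite expg0 mul1g invg1 mulg1.
have Ak3 : maps_to p3 (conjk A) (conjk B).
  by have := p3k 1%N isT; rewrite expg1.
have AAk3 : maps_to p3 (conjk (A ^+ 2)) k.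
  by have := p3k 2%N isT; rewrite subnn expg0 mul1g invg1 mulg1.
have b3k : maps_to (b p3) k (conjk (B * A ^+ 2)).
  apply: maps_to_twist k3 _; rewrite -(conjkM B) (conjkM B (B ^+ 2)) -expgS.
  exact: maps_to_conj.
have b2k : maps_to (b p2) k (conjk (B * A)).
  apply: maps_to_twist k2 _; rewrite -(conjkM B) (conjkM B B) -[B * B]/(B ^+ 2).
  exact: maps_to_conj.
(* [p3] yields [conjk (B^4)], and [B] turns it into [conjk (B^5)]. Splitting [B^5] as [B^3 B^2]
   exhibits the image under [p3] of [conjk B]. *)
have b3b2k : maps_to (b p3) (conjk (B * A)) (conjk B).
  rewrite -(conjkM B); apply: maps_to_twist (maps_to_conj p3B Ak3) _.
  rewrite !conjkM -expgSr -expgS (expgnDr B 3 2) -conjkM.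
  exact: maps_to_conj.
have b2b3k : maps_to (b p2) (conjk (B * A ^+ 2)) (conjk (B * A * B * A ^+ 2)).
  rewrite -(conjkM B) -[conjk (A ^+ 2)]/(A ^+ 2 * k * (A ^+ 2)^-1).
  apply: maps_to_twist (maps_to_conj p2B (maps_to_conj p2A k2)) _.
  (* [p2] is known on [A^2], [B], [k] and [conjk A], but not on [A]. The conjugator is rewritten so
     that its last [A] is absorbed into [conjk A] and the rest is a product of known elements. *)
  have -> : conjk (B * A * B * A ^+ 2) =
      (B * (k * (B * A ^+ 2 * B^-1)) * B) * conjk A *
      (B * (k * (B * A ^+ 2 * B^-1)) * B)^-1.
    rewrite conjkM; suff -> : B * A * B * A ^+ 2 =
      B * (k * (B * A ^+ 2 * B^-1)) * B * A by [].
    by rewrite /commutator expgS expg1 !mulgA !mulgVK.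
  have e : B ^+ 2 * (conjk B * (B ^+ 2 * A * (B ^+ 2)^-1)) * B ^+ 2 =
      B * (B ^+ 2 * (A * B)).
    by rewrite /commutator !expgS expg0 !mulg1 !invgM !mulgA !mulgVK.
  rewrite (conjkM A B) (conjkM (B ^+ 2)) (conjkM B) -e.
  apply: maps_to_conj Ak2.
  by do !apply: maps_toM => //; exact: maps_toV.
pose P2 := comm_class p2; pose P3 := comm_class p3.
pose y := comm_class (inner B); exists (P3 * P2^-1), y.
have e2 : P2 * y * P2^-1 = y ^+ 2.
  by rewrite (comm_class_conj p2B) comm_class_innerX.
have e3 : P3 * y * P3^-1 = y ^+ 3.
  by rewrite (comm_class_conj p3B) comm_class_innerX.
split; first by rewrite -e2 -e3 invgM invgK !mulgA !mulgVK.
have bE p : comm_class (b p) = (comm_class p)^-1 * y * comm_class p.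
  by rewrite /b !comm_classM comm_classV mulgA.
(* Conjugation by [P3^-1] turns [x * y * x^-1] and [y] into the classes of [b p2] and [b p3]. *)
move=> com; have : comm_class (fi_comp (b p2) (b p3)) =
    comm_class (fi_comp (b p3) (b p2)).
  rewrite (comm_classM (b p2)) (comm_classM (b p3)) !bE -/P2 -/P3.
  apply: (@mulgI _ P3); apply: (@mulIg _ P3^-1); move: com; rewrite /commute.
  by rewrite invgM invgK !mulgA !mulgV mul1g !mulgK.
move=> /comm_class_eq/(_ (maps_to_comp b3k b2b3k) (maps_to_comp b2k b3b2k)).
have [F [FA FB]] := affine_test hG rw.
by move=> [r r0]; exact: (affine_conj_commutator FA FB r0).
Qed.

End HandleCommensurator.

(** * Commensurability invariance of the commensurator *)

Section Transfer.
Local Open Scope group_scope.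
Local Open Scope classical_set_scope.

(** Total maps with junk values outside the subgroups match the convention of [fi_map] and compose
    with it directly. *)
Record subgroup_iso (G1 G2 : groupType) (H1 : subgroup G1) (H2 : subgroup G2)
    (t : G1 -> G2) (s : G2 -> G1) : Prop := SubgroupIso {
  siso_fun : forall x, sg_set H1 x -> sg_set H2 (t x);
  siso_inv : forall y, sg_set H2 y -> sg_set H1 (s y);
  siso_funK : forall x, sg_set H1 x -> s (t x) = x;
  siso_invK : forall y, sg_set H2 y -> t (s y) = y;
  siso_funM : forall x y, sg_set H1 x -> sg_set H1 y -> t (x * y) = t x * t y }.

Lemma siso_sym (G1 G2 : groupType) (H1 : subgroup G1) (H2 : subgroup G2) t s :
  subgroup_iso H1 H2 t s -> subgroup_iso H2 H1 s t.
Proof.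
move=> [tH sH tK sK tM]; split=> // x y Hx Hy.
by rewrite -[RHS]tK ?tM ?sK //; [exact: sH|exact: sH|apply: sgM; exact: sH].
Qed.

Lemma isomorphic_siso (G1 G2 : groupType) (H1 : subgroup G1)
    (H2 : subgroup G2) : isomorphic (subgroup_type H1) (subgroup_type H2) ->
  exists t s, subgroup_iso H1 H2 t s.
Proof.
move=> [f [g fK gK]].
pose t x := if insub x is Some u then val (f u) else 1.
pose s y := if insub y is Some u then val (g u) else 1.
have tE u : t (val u) = val (f u) by rewrite /t valK.
have sE u : s (val u) = val (g u) by rewrite /s valK.
have ex1 x : sg_set H1 x -> exists u : subgroup_type H1, val u = x.
  by move=> /mem_set Hx; exists (Sub x Hx); rewrite SubK.
have ex2 y : sg_set H2 y -> exists u : subgroup_type H2, val u = y.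
  by move=> /mem_set Hy; exists (Sub y Hy); rewrite SubK.
exists t, s; split.
- by move=> _ /ex1[u <-]; rewrite tE; exact/set_mem/(valP (f u)).
- by move=> _ /ex2[u <-]; rewrite sE; exact/set_mem/(valP (g u)).
- by move=> _ /ex1[u <-]; rewrite tE sE fK.
- by move=> _ /ex2[u <-]; rewrite sE tE gK.
- move=> _ _ /ex1[u <-] /ex1[v <-].
  by rewrite -[val u * val v]/(val (u * v)) !tE gmulfM.
Qed.

Section Pullback.
Variables (G1 G2 : groupType) (H1 : subgroup G1) (H2 : subgroup G2).
Variables (t : G1 -> G2) (s : G2 -> G1).
Hypothesis i12 : subgroup_iso H1 H2 t s.

Lemma siso_fun1 : t 1 = 1.
Proof.
by apply: (@mulgI _ (t 1)); rewrite -(siso_funM i12) ?mulg1 //; exact: sg1.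
Qed.

Lemma siso_funV x : sg_set H1 x -> t x^-1 = (t x)^-1.
Proof.
move=> Hx; apply: (@mulgI _ (t x)).
by rewrite -(siso_funM i12) ?mulgV ?siso_fun1 //; exact: sgV.
Qed.

Variable K : subgroup G2.

Definition pullback_set : set G1 := [set x | sg_set H1 x /\ sg_set K (t x)].

Fact pullback1 : pullback_set 1.
Proof. by split; [exact: sg1|rewrite siso_fun1; exact: sg1]. Qed.

Fact pullbackF x y : pullback_set x -> pullback_set y -> pullback_set (x / y).
Proof.
move=> [Hx Kx] [Hy Ky]; split; first exact: sgF.
by rewrite (siso_funM i12) ?siso_funV //; [exact: sgF|exact: sgV].
Qed.

Definition pullback : subgroup G1 := mk_subgroup pullback1 pullbackF.

(** Dividing [x] by a representative of its coset lands in [H1], where [t] is meaningful; the coset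
    of [x] and the coset of the resulting value together determine the class of [x]. *)
Lemma pullback_index : finite_index H1 -> finite_index K ->
  finite_index pullback.
Proof.
move=> fH fK.
have /choice[r rP] (X : set G1) : exists x, X !=set0 -> X x.
  by have [[x Xx]|nX] := pselect (X !=set0); [exists x|exists 1].
pose u x := (r (left_coset H1 x))^-1 * x.
have Hu x : sg_set H1 (u x).
  apply/left_cosetP.
  have /rP[h Hh e] : left_coset H1 x !=set0.
    by exists x; exists 1; rewrite ?mulg1 //; exact: sg1.
  by apply/left_cosetP; rewrite -e invgM mulgVK; exact: sgV.
apply: (@finite_indexP _ _ _
  (fun x => (left_coset H1 x, left_coset K (t (u x))))).
  apply: sub_finite_set (finite_setX fH fK) => _ [x _ <-].
  by split; eexists.
move=> x y [e /left_cosetP].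
have <- : (u x)^-1 * u y = x^-1 * y.
  by rewrite /u e invgM invgK -mulgA mulVKg.
rewrite -siso_funV // -(siso_funM i12) //; last exact: sgV.
by split=> //; apply: sgM => //; exact: sgV.
Qed.

End Pullback.

Section TransferIso.
Variables (G1 G2 : groupType) (H1 : subgroup G1) (H2 : subgroup G2).
Hypotheses (fH1 : finite_index H1) (fH2 : finite_index H2).
Variables (t : G1 -> G2) (s : G2 -> G1).
Hypothesis i12 : subgroup_iso H1 H2 t s.

(** The values of [phi] must return to [H2], since [s] is meaningful only there. *)
Definition transfer_dom (phi : fi_iso G2) : subgroup G1 :=
  pullback i12 (fi_preimage phi H2).

Fact transfer_index phi : finite_index (transfer_dom phi).
Proof. exact: pullback_index fH1 (fi_preimage_index phi fH2). Qed.

Fact transfer_mapM (phi : fi_iso G2) x y : sg_set (transfer_dom phi) x ->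
  sg_set (transfer_dom phi) y ->
  s (phi (t (x * y))) = s (phi (t x)) * s (phi (t y)).
Proof.
move=> [Hx [Dx Px]] [Hy [Dy Py]].
by rewrite (siso_funM i12) // fi_mapM // (siso_funM (siso_sym i12)).
Qed.

Fact transfer_bij (phi : fi_iso G2) : set_bij (sg_set (transfer_dom phi))
  (sg_set (transfer_dom (fi_inv phi))) (fun x => s (phi (t x))).
Proof.
split=> [x [Hx [Dx Px]]|x y|y [Hy [Cy Py]]].
- split; first exact: (siso_inv i12).
  rewrite (siso_invK i12) //; split; first exact: fi_fun.
  by rewrite /= fi_inv_mapK //; exact: (siso_fun i12).
- move=> /set_mem[Hx [Dx Px]] /set_mem[Hy [Dy Py]] e.
  rewrite -(siso_funK i12 Hx) -(siso_funK i12 Hy); congr s.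
  by apply: (fi_inj Dx Dy); rewrite -(siso_invK i12 Px) -(siso_invK i12 Py) e.
- have [Dz e] := fi_inv_mapP Cy; exists (s (fi_inv_map phi (t y))).
    split; first exact: (siso_inv i12).
    rewrite (siso_invK i12) //; split=> //=.
    by rewrite e; exact: (siso_fun i12).
  by rewrite (siso_invK i12) // e (siso_funK i12).
Qed.

Definition transfer (phi : fi_iso G2) : fi_iso G1 :=
  FiIso (transfer_index phi) (transfer_index (fi_inv phi)) (@transfer_mapM phi)
    (transfer_bij phi).

Lemma transfer_eqv phi psi :
  comm_eqv phi psi -> comm_eqv (transfer phi) (transfer psi).
Proof.
move=> [K [fK Kphi Kpsi e]].
exists (pullback i12 (cap_subgroup K (fi_preimage phi H2))); split.
- apply: pullback_index fH1 (finite_index_cap fK _).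
  exact: fi_preimage_index.
- by move=> x [Hx [Kx Dx]].
- move=> x [Hx [Kx [Dx Px]]]; split=> //; split; first exact: Kpsi.
  by rewrite /= -e.
- by move=> x [Hx [Kx _]] /=; rewrite e.
Qed.

Lemma transfer_comp phi psi : comm_eqv (transfer (fi_comp phi psi))
  (fi_comp (transfer phi) (transfer psi)).
Proof.
(* Composing after transfer also requires the intermediate value to lie in [H2], so that domain is
   the smaller one. *)
apply/comm_sym/comm_sub => [x|x] [[Hx [Dx Px]] [_ [Dy Py]]];
  by move: Dy Py; rewrite /= (siso_invK i12).
Qed.

Lemma transfer_inj phi : comm_eqv (transfer phi) (@fi_id G1) ->
  comm_eqv phi (@fi_id G2).
Proof.
move=> [K [fK Kphi _ e]]; have i21 := siso_sym i12.
exists (pullback i21 K); split=> //.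
- exact: pullback_index.
- by move=> y [Hy /Kphi[_ []]]; rewrite (siso_invK i12).
- move=> y [Hy Ky]; have [_ [_]] := Kphi _ Ky; have := e _ Ky.
  rewrite /= (siso_invK i12) // => E Py.
  by rewrite -[RHS](siso_invK i12 Hy) -E (siso_invK i12).
Qed.

End TransferIso.

(** Shrinking the domain of a representative to finite index keeps its class and makes it a map
    within [H2], which the isomorphism carries to [G1]. *)
Lemma comm_embedding (G1 G2 : groupType) : commensurable G1 G2 ->
  exists f : {multiplicative (Comm G2) -> Comm G1}, injective f.
Proof.
move=> [H1 [H2 [fH1 fH2 /isomorphic_siso[t [s i12]]]]].
pose T (u : Comm G2) : Comm G1 :=
  comm_class (transfer fH1 fH2 i12 (pg_repr u)).
have TE phi : T (comm_class phi) = comm_class (transfer fH1 fH2 i12 phi).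
  by apply/pg_classE/transfer_eqv; exact: (@pg_classK (comm_pregroup G2)).
have repr u : exists phi, u = comm_class phi :> Comm G2.
  by exists (pg_repr u); rewrite /comm_class pg_reprK.
have TM : {morph T : u v / u * v}.
  move=> u v; have [phi ->] := repr u; have [psi ->] := repr v.
  rewrite -comm_classM !TE -comm_classM; apply/pg_classE.
  exact: transfer_comp.
pose F : {multiplicative (Comm G2) -> Comm G1} :=
  HB.pack T (isMultiplicative.Build _ _ T TM).
exists F => u v e; apply/divg1_eq.
have : F (u / v) = 1 by rewrite gmulfM multV e mulgV.
have [phi ->] := repr (u / v); rewrite [LHS]TE => /pg_classE/transfer_inj E.
exact/pg_classE.
Qed.

Lemma comm_BS_of_handle (Gamma G : groupType) (A B : G) (J : choiceType)
    (c : J -> G) (w : word J) (n : nat) :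
  handle A B c w -> retractable w -> commensurable Gamma G -> 1 < n ->
  (exists H : subgroup (Comm Gamma), isomorphic (subgroup_type H) (BS 1%Z n)) /\
  (exists f : {multiplicative (BS 2%Z 3%Z) -> (Comm Gamma)},
     ~ residually_finite (subgroup_type (image_subgroup f))).
Proof.
move=> hG rw /comm_embedding[F injF] n1; split.
  have [x [y [e inf]]] := comm_BS1 hG rw n1.
  apply: (@BS1_in_comm _ _ (F x) (F y) n1).
    by rewrite -multV -multX -!gmulfM e.
  by move=> k; rewrite -multX -(mult1 F) => /injF/inf.
have [x [y [e nc]]] := comm_BS23 hG rw.
apply: (@BS23_not_rf _ (F x) (F y)).
  by rewrite -multV -!multX -!gmulfM e.
by move=> E; apply: nc; apply: injF; rewrite gmulfM !gmulfM multV.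
Qed.

End Transfer.

(** * The free and the genus-two cases *)

Local Open Scope ring_scope.

Theorem theorem1 (R : realType) (Gamma : groupType) (n : int) :
  surface_group R Gamma ->
  commensurable Gamma free2 \/ commensurable Gamma Gamma2 ->
  1 < n ->
  (exists H : subgroup (Comm Gamma),
     isomorphic (subgroup_type H) (BS 1%Z n)) /\
  (exists f : {multiplicative (BS 2%Z 3%Z) -> (Comm Gamma)},
     ~ residually_finite (subgroup_type (image_subgroup f))).
Proof.
move=> _ com; case: n => // n n1.
case: com => com.
- have [A [B [c hG]]] := free2_handle.
  apply: (comm_BS_of_handle hG _ com n1) => M a b.
  by exists (fun=> Defs.commutator a b); rewrite /= /eval_letter /= mulg1.
- have [A [B [c hG]]] := Gamma2_handle.
  apply: (comm_BS_of_handle hG _ com n1) => M a b.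
  (* The retraction folds the second handle onto the first, with [D] sent to [a] and [C] to [b]. *)
  by exists (fun i : bool => if i then a else b); rewrite eval_commutator_word.
Qed.
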